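(* For $a\in[0.3,0.6]$ let $P_a$ be the convex quadrilateral with vertices $A=(0,1)$, $B=(a,1)$, $C=(1,0.2)$, $D=(0,0)$, let $\lambda=0.8$, and let $T$ be the outer billiards map with contraction $\lambda$ outside $P_a$. For uncountably many values of $a\in[0.3,0.6]$, for all sufficiently small $\epsilon>0$ there exists a Cantor set which attracts all points of $X\cap(R_1\cup R_2)$, i.e. a Cantor set $K\subset\mathbb R^2$ with every $p\in X\cap(R_1\cup R_2)$ asymptotic to $K$.
   Context: Outer billiards with contraction: for a convex polygon $P$ and $0<\lambda<1$, given a generic $x\in\mathbb R^2\setminus P$ there is a unique vertex $v$ of $P$ such that $P$ lies on the left of the ray from $x$ through $v$; set $Tx=(1+\lambda)v-\lambda x$. If $A_1,\dots,A_n$ are the vertices of $P$ in clockwise order, let $S$ be the union of the rays $\overrightarrow{A_1A_2},\dots,\overrightarrow{A_nA_1}$ (starting at the first point and containing the side); $T$ is defined on $\mathbb R^2\setminus(P\cup S)$. Let $X=\mathbb R^2\setminus\big(P\cup\bigcup_{i\ge0}T^{-i}S\big)$, the set of points whose whole forward orbit is defined. A point $x\in X$ is asymptotic to a closed set $K$ if its $\omega$-limit set under $T$ equals $K$ (all orbits are bounded). A Cantor set is a set homeomorphic to the middle-thirds set. Rectangles: let $\mu=1/\lambda$, $l=\mu+(1-a)\mu^2$. For $\epsilon>0$ small, $R_1=[-l+\epsilon,0]\times[1,1+\epsilon^2]$ and $R_2=[-l+\epsilon,0]\times[1-\epsilon^2,1]$. *)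

(* Defs.v *)
From mathcomp Require Export all_boot all_order all_algebra.
From mathcomp Require Export all_classical all_reals all_analysis.

Set Implicit Arguments.
Unset Strict Implicit.
Unset Printing Implicit Defensive.

Import Order.TTheory GRing.Theory Num.Theory.
Import numFieldNormedType.Exports.

Local Open Scope classical_set_scope.
Local Open Scope ring_scope.

Section OuterBilliards.
Context {R : realType}.

Definition cross (u v : R * R) : R := u.1 * v.2 - u.2 * v.1.

Definition ray (p q : R * R) : set (R * R) :=
  [set p + t *: (q - p) | t in [set t : R | 0 <= t]].

(* A convex polygon is given by the tuple A of its vertices, listed in clockwise
   order; polygon A is their (closed) convex hull. The constructions on A presuppose
   that it is in convex position and so ordered. *)
Definition polygon n (A : n.-tuple (R * R)) : set (R * R) :=
  [set p | exists t : 'I_n -> R,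
     [/\ forall i, 0 <= t i, \sum_i t i = 1 & p = \sum_i t i *: tnth A i]].

Definition singular_set n (A : n.-tuple (R * R)) : set (R * R) :=
  \bigcup_(i : 'I_n) ray (tnth A i) (tnth A (ordS i)).

Definition left_vertices n (A : n.-tuple (R * R)) (x : R * R) : set (R * R) :=
  [set v | v \in A /\
     forall p, polygon A p -> 0 <= cross (v - x) (p - x)].

(* Totalized: for x outside polygon A `|` singular_set A, left_vertices A x is
   a singleton and xget returns its element; elsewhere the value is irrelevant. *)
Definition outer_billiard (lam : R) n (A : n.-tuple (R * R)) (x : R * R) :
    R * R :=
  let v := xget 0 (left_vertices A x) in (1 + lam) *: v - lam *: x.

(* The conventional values of outer_billiard do not affect this set: orbits of
   points outside the polygon stay outside it, so the first point of an orbit at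
   which the map is undefined lies in singular_set A. *)
Definition regular_points (lam : R) n (A : n.-tuple (R * R)) : set (R * R) :=
  ~` (polygon A `|`
      \bigcup_i (iter i (outer_billiard lam A) @^-1` singular_set A)).

Fixpoint middle_thirds_stage (n : nat) : set R :=
  if n is m.+1 then
    [set x / 3 | x in middle_thirds_stage m] `|`
    [set (2 + x) / 3 | x in middle_thirds_stage m]
  else `[0, 1].

Definition middle_thirds : set R := \bigcap_n middle_thirds_stage n.

End OuterBilliards.

Definition homeomorphic_sets (U V : topologicalType) (A : set U) (B : set V) :=
  exists (f : U -> V) (g : V -> U),
    [/\ {within A, continuous f}, {within B, continuous g},
        f @` A `<=` B, g @` B `<=` A &
        (forall x, A x -> g (f x) = x) /\ (forall y, B y -> f (g y) = y)].

Definition is_Cantor_set (R : realType) (U : topologicalType) (K : set U) :=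
  homeomorphic_sets K (@middle_thirds R).

Definition omega_limit (U : topologicalType) (f : U -> U) (x : U) : set U :=
  cluster ((fun n => iter n f x) @ \oo).

(* K is then automatically closed, since omega-limit sets are. *)
Definition asymptotic_to (U : topologicalType) (f : U -> U) (x : U)
    (K : set U) :=
  omega_limit f x = K.

Section Quadrilateral.
Context {R : realType}.

Definition quad (a : R) : 4.-tuple (R * R) :=
  [tuple (0, 1); (a, 1); (1, 1 / 5); (0, 0)].

Definition rect_length (lam a : R) : R :=
  let mu := 1 / lam in mu + (1 - a) * mu ^+ 2.

Definition rect1 (lam a eps : R) : set (R * R) :=
  `[- rect_length lam a + eps, 0] `*` `[1, 1 + eps ^+ 2].

Definition rect2 (lam a eps : R) : set (R * R) :=
  `[- rect_length lam a + eps, 0] `*` `[1 - eps ^+ 2, 1].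

End Quadrilateral.

(* Main.v *)
From HB Require Import structures.
Require Import Defs.
From mathcomp Require Import ring lra zify.

Set Implicit Arguments.
Unset Strict Implicit.
Unset Printing Implicit Defensive.

Import Order.TTheory GRing.Theory Num.Theory.
Import numFieldNormedType.Exports.

Local Open Scope classical_set_scope.
Local Open Scope ring_scope.

(** Near the line through A and B, to the left of A, the vertices that an orbit
turns around depend only on its side of that line. A point (s, 1 + h) with
s < 0 and h < 0 small turns around D, C and B and reaches the abscissa
[offset s], now above the line. If this abscissa is positive, a turn around A
brings the point back below the line; if it is negative, turns around D, C and
A do. The height h is multiplied by (4/5)^4 or (4/5)^6 meanwhile, so it tends
to 0, and what remains is the dynamics of s under the first return map. That
map is a [contracted_rotation]: it is affine and increasing on either side of a
cut and contracts there, and after gluing the ends of the interval [- len, 0]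
it becomes a continuous injection of the circle into itself, except for one
jump; its image misses an arc.

Such a map has a rotation number. When that number is an irrational rho, the
missed arc and its images are disjoint gaps, which lie along the interval in the
same order as the orbit of rho under the rotation by rho lies along the circle;
the ratios of their lengths are products of slopes. This suggests defining everything from
rho: [phi] is the increasing function that jumps by those lengths at the points
of that orbit, and it conjugates the rotation to the contracted rotation whose
cut is the value of [phi] at 1 - rho ([phi_rot]). The cut determines a. For rho
in ]1/2, 1[ this a lies in the required range ([parameter_itv]), and distinct
rho give distinct a, because the itinerary of - len under the return map
records the integer parts of the multiples of rho ([cut_inj]). Hence there are
uncountably many such a.

Fix one of them. An abscissa that never meets the cut belongs to the closed gap
(possibly a single point) that some x of the circle labels, and stays on the
same side of the cut as [phi x]; hence its orbit is attracted to the orbit of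
[phi x] ([follows_step]). As the rotation orbit of x is dense and [phi] is
right-continuous, the omega-limit set is the closure of the range of [phi],
spread over the four or six points of each excursion ([omega_limit_core]). The
points whose abscissa meets the cut fall on the singular set, so they are
excluded.

This closure K is a Cantor set: it is compact; it has no isolated point, since
[phi] is strictly increasing and right-continuous; and any two of its points are
separated by a clopen subset, since the jumps of [phi] are dense and thus both
coordinates of K avoid a dense set of values ([phi_range_gap]). *)

(** * Subsets homeomorphic to the Cantor space *)

Lemma homeomorphic_sets_sym (U V : topologicalType) (A : set U) (B : set V) :
  homeomorphic_sets A B -> homeomorphic_sets B A.
Proof. by move=> [f [g [cf cg fA gB [fK gK]]]]; exists g, f. Qed.

Lemma within_continuous_comp (U V W : topologicalType) (A : set U) (B : set V)
    (f : U -> V) (g : V -> W) :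
  {within A, continuous f} -> {within B, continuous g} -> f @` A `<=` B ->
  {within A, continuous (g \o f)}.
Proof.
move=> /subspace_continuousP cf /subspace_continuousP cg fAB.
apply/subspace_continuousP => x Ax.
have Bfx : B (f x) by apply: fAB; exists x.
apply: (cvg_comp _ _ _ (cg _ Bfx)) => P /= wP.
have := cf _ Ax _ wP; rewrite /nbhs /= /within /=.
move=> H; near=> y => Ay.
by have /= := near H y; apply => //; apply: fAB; exists y.
Unshelve. all: by end_near. Qed.

Lemma homeomorphic_sets_trans (U V W : topologicalType) (A : set U) (B : set V)
    (C : set W) :
  homeomorphic_sets A B -> homeomorphic_sets B C -> homeomorphic_sets A C.
Proof.
move=> [f [g [cf cg fA gB [fK gK]]]] [f' [g' [cf' cg' fB gC [fK' gK']]]].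
exists (f' \o f), (g \o g'); split.
- exact: within_continuous_comp cf cf' fA.
- exact: within_continuous_comp cg' cg gC.
- by move=> _ [x Ax <-]; apply: fB; exists (f x) => //; apply: fA; exists x.
- by move=> _ [x Ax <-]; apply: gB; exists (g' x) => //; apply: gC; exists x.
split=> [x Ax|y Cy] /=.
  by rewrite fK' ?fK//; apply: fA; exists x.
by rewrite gK ?gK'//; apply: gC; exists y.
Qed.

Section cantor_like_subsets.
Context {R : realType} {U : pseudoMetricType R}.

(** The characterization of the Cantor space is about types, so K is given here
as the range of an injection from a type, which carries the initial topology. *)
Lemma homeomorphic_cantor_space_range (S : pointedType) (i : S -> U)
    (K := range i) :
  injective i -> hausdorff_space U -> compact K ->
  (forall x A, K x -> nbhs x A -> exists y, [/\ K y, A y & y != x]) ->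
  (forall x y, K x -> K y -> x != y -> exists V W : set U,
    [/\ open V, open W, V x, W y & K `<=` V `|` W /\ K `&` V `&` W = set0]) ->
  homeomorphic_sets K [set: cantor_space].
Proof.
move=> iinj hU cK perfK sepK.
pose T : pseudoPMetricType R := HB.pack (initial_topology i)
  (isPointed.Build (initial_topology i) (point : S)).
have iK s : K (i s) by exists s.
have ci : continuous (i : T -> U) by exact: initial_continuous.
have [j ji] : exists j : U -> T, forall s, j (i s) = s.
  exists (fun u => xget point [set s | i s = u]) => s.
  apply: iinj; apply: (@xgetPex _ (point : T) [set t | i t = i s]).
  by exists s.
have ij u : K u -> i (j u) = u by move=> [s _ <-]; rewrite ji.
have cj : {within K, continuous j}.
  apply/subspace_continuousP => x Kx P /=.
  rewrite nbhsE => -[Q [[V oV <-]]] /=; rewrite /preimage /= ij// => Vx VP.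
  have : nbhs x V by apply: open_nbhs_nbhs.
  rewrite /within /= nbhs_simpl => nV; rewrite /nbhs /=; near=> y => Ky.
  by apply: VP => /=; rewrite /preimage /= ij//; near: y.
have cT : cantor_like T.
  split.
  - apply/perfectTP => s os.
    have : nbhs (s : T) [set s] by apply: open_nbhs_nbhs.
    rewrite nbhsE => -[Q [[V oV <-]]] Vs VP.
    have nV : nbhs (i s) V by apply: open_nbhs_nbhs.
    have [y [Ky Vy /eqP yx]] := perfK _ _ (iK s) nV.
    apply: yx; rewrite -(ij _ Ky); congr i; apply: VP => /=.
    by rewrite /preimage /= ij.
  - have -> : [set: T] = j @` K.
      by apply/seteqP; split=> // s _; exists (i s).
    exact: continuous_compact cj cK.
  - move=> s t st; apply: iinj; apply: hU => A B nA nB.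
    have := st (i @^-1` A) (i @^-1` B) (ci _ _ nA) (ci _ _ nB).
    by move=> [u [Au Bu]]; exists (i u).
  - move=> s t st.
    have : i s != i t by apply: contra st => /eqP /iinj ->.
    move=> /(sepK _ _ (iK s) (iK t)) [V [W [oV oW Vs Wt [VW0 VW]]]].
    exists (i @^-1` V); split => //.
      split; first by exists V.
      suff -> : i @^-1` V = ~` (i @^-1` W : set T).
        by apply: open_closedC; exists W.
      apply/seteqP; split=> u /=.
        by move=> Vu Wu; have : set0 (i u) by rewrite -VW.
      by move=> nWu; have [] := VW0 _ (iK u).
    by move=> Vt; have : set0 (i t) by rewrite -VW.
have [f [cf cl]] := @homeomorphism_cantor_like R T cT.
pose h := (f^-1)%FUN.
have fh : cancel h f by move=> t; rewrite /h invK // inE.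
have hf : cancel f h by move=> t; rewrite /h funK // inE.
apply: homeomorphic_sets_sym; exists (i \o f), (h \o j); split.
- apply: continuous_subspaceT => x; apply: continuous_comp; first exact: cf.
  exact: ci.
- apply: (@within_continuous_comp _ _ _ _ setT) => //.
  apply: continuous_subspaceT; apply/continuous_closedP => A /cl.
  suff -> : h @^-1` A = f @` A by [].
  apply/seteqP; split=> [t At|_ [c Ac <-]]; first by exists (h t).
  by rewrite /preimage /= hf.
- by move=> _ [c _ <-]; exact: iK.
- by [].
by split=> [c _|u Ku] /=; rewrite ?ji ?hf// fh ij.
Unshelve. all: by end_near. Qed.

(** Brouwer's characterization, in terms of the ambient space only. *)
Lemma homeomorphic_cantor_space (K : set U) :
  hausdorff_space U -> K !=set0 -> compact K ->
  (forall x A, K x -> nbhs x A -> exists y, [/\ K y, A y & y != x]) ->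
  (forall x y, K x -> K y -> x != y -> exists V W : set U,
    [/\ open V, open W, V x, W y & K `<=` V `|` W /\ K `&` V `&` W = set0]) ->
  homeomorphic_sets K [set: cantor_space].
Proof.
move=> hU [x0 /mem_set Kx0].
pose S : pointedType :=
  HB.pack (set_type K) (isPointed.Build (set_type K) (SigSub Kx0)).
have <- : range (set_val : S -> U) = K.
  apply/seteqP; split=> [_ [[x /= Kx] _ <-]|x Kx]; first exact: set_mem Kx.
  by exists (SigSub (mem_set Kx) : set_type K).
by apply: homeomorphic_cantor_space_range => //; exact: val_inj.
Qed.

End cantor_like_subsets.

(** * The middle-thirds set *)

Lemma exprn_mul_eventually_le {R : realType} (k e d : R) :
  0 < k < 1 -> 0 < d -> exists N, forall n, (N <= n)%N -> k ^+ n * e <= d.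
Proof.
move=> /andP[k0 k1] d0; have : (fun n => k ^+ n * e) @ \oo --> 0 * e.
  by apply: cvgMl; apply: cvg_expr; rewrite gtr0_norm.
rewrite mul0r => /cvgr0Pnorm_lt /(_ _ d0)[N _ H]; exists N => n /H /= h.
exact/ltW/(le_lt_trans (ler_norm _) h).
Qed.

Lemma exprn_lt_eventually {R : realType} (k d : R) :
  0 < k < 1 -> 0 < d -> exists n, k ^+ n < d.
Proof.
move=> k01 d0; have d2 : 0 < d / 2 by rewrite divr_gt0.
have [n nd] := exprn_mul_eventually_le 1 k01 d2.
by exists n; have := nd n (leqnn n); rewrite mulr1; lra.
Qed.

Section middle_thirds.
Context {R : realType}.
Local Notation stage := (@middle_thirds_stage R).
Local Notation M := (@middle_thirds R).

Lemma middle_thirds_stage_compact n : compact (stage n).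
Proof.
elim: n => [|n IHn] /=; first exact: segment_compact.
apply: compactU; apply: continuous_compact => //; apply: continuous_subspaceT => x.
  by apply: cvgMl; exact: cvg_id.
by apply: cvgMl; apply: cvgD; [exact: cvg_cst|exact: cvg_id].
Qed.

Lemma middle_thirds_compact : compact M.
Proof.
apply: (@subclosed_compact _ _ (stage 0)); last first.
- by move=> x /(_ 0%N I).
- exact: middle_thirds_stage_compact.
- apply: closed_bigI => n _; apply: compact_closed; first exact: Rhausdorff.
  exact: middle_thirds_stage_compact.
Qed.

Lemma middle_thirds_stageS n x : stage n.+1 x -> stage n x.
Proof.
elim: n x => [|n IHn] x.
  by case=> -[y /=]; rewrite !in_itv /= => /andP[y0 y1] <-; apply/andP; split; lra.
by case=> -[y /IHn yn <-]; [left|right]; exists y.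
Qed.

Lemma middle_thirds_itv x : M x -> 0 <= x <= 1.
Proof. by move=> /(_ 0%N I) /=; rewrite in_itv. Qed.

Lemma middle_thirds_left x : M x -> M (x / 3).
Proof.
move=> Mx n _; have := Mx n I; case: n => [|n] xn /=; last first.
  by left; exists x => //; exact: Mx.
by move: xn; rewrite /= !in_itv /= => /andP[? ?]; apply/andP; split; lra.
Qed.

Lemma middle_thirds_right x : M x -> M ((2 + x) / 3).
Proof.
move=> Mx n _; have := Mx n I; case: n => [|n] xn /=; last first.
  by right; exists x => //; exact: Mx.
by move: xn; rewrite /= !in_itv /= => /andP[? ?]; apply/andP; split; lra.
Qed.

Lemma middle_thirdsP x : M x ->
  (exists2 y, M y & x = y / 3) \/ (exists2 y, M y & x = (2 + y) / 3).
Proof.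
move=> Mx; have x01 := middle_thirds_itv Mx.
have st n y : stage n y -> 0 <= y <= 1.
  by elim: n y => [|n IH] y; [rewrite /= in_itv|move/middle_thirds_stageS/IH].
have [xh|xh] := lerP x (1 / 2); [left|right].
  exists (3 * x) => [n _|]; last by field.
  have [] := Mx n.+1 I => -[y yn E]; have := st _ _ yn; first by rewrite -E mulrC divfK.
  by lra.
exists (3 * x - 2) => [n _|]; last by field.
have [] := Mx n.+1 I => -[y yn E]; have := st _ _ yn; first by lra.
by rewrite -E; have -> : 3 * ((2 + y) / 3) - 2 = y by field.
Qed.

Lemma middle_thirds0 : M 0.
Proof.
move=> n _; elim: n => [|n IHn] /=; first by rewrite in_itv /= lexx ler01.
by left; exists 0 => //; rewrite mul0r.
Qed.

Lemma middle_thirds1 : M 1.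
Proof.
move=> n _; elim: n => [|n IHn] /=; first by rewrite in_itv /= lexx ler01.
by right; exists 1 => //; field.
Qed.

(** Self-similarity: both ends 0 and 1 belong to the set, and each of the two
maps onto its thirds divides distances by 3. *)
Lemma middle_thirds_neighbour n x : M x ->
  exists y, [/\ M y, y != x & `|x - y| <= (1 / 3) ^+ n].
Proof.
elim: n x => [|n IHn] x Mx.
  have /andP[x0 x1] := middle_thirds_itv Mx.
  have [->|xn0] := eqVneq x 0.
    exists 1; split; [exact: middle_thirds1|exact: oner_neq0|].
    by rewrite sub0r normrN normr1 expr0.
  exists 0; split; [exact: middle_thirds0|by rewrite eq_sym|].
  by rewrite subr0 ger0_norm ?expr0.
have third : forall (b u v : R), `|u - v| <= (1 / 3) ^+ n ->
    `|(b + u) / 3 - (b + v) / 3| <= (1 / 3) ^+ n.+1.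
  move=> b u v uv; have -> : (b + u) / 3 - (b + v) / 3 = 1 / 3 * (u - v) by field.
  by rewrite normrM gtr0_norm ?exprS ?ler_pM2l// divr_gt0.
have [[y My ->]|[y My ->]] := middle_thirdsP Mx; have [z [Mz zy yz]] := IHn _ My.
  exists (z / 3); split; first exact: middle_thirds_left.
    by apply: contra zy => /eqP E; apply/eqP; lra.
  by have := third 0 _ _ yz; rewrite !add0r.
exists ((2 + z) / 3); split; first exact: middle_thirds_right.
  by apply: contra zy => /eqP E; apply/eqP; lra.
exact: third.
Qed.

(** If both points lie in the same third, enlarge that third; otherwise 1/2
separates them. *)
Lemma middle_thirds_gap n x y : M x -> M y -> (1 / 3) ^+ n < y - x ->
  exists2 z, x < z < y & ~ M z.
Proof.
elim: n x y => [|n IHn] x y Mx My.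
  move: (middle_thirds_itv Mx) (middle_thirds_itv My); rewrite expr0; lra.
have n1 : ~ M (1 / 2).
  case/middle_thirdsP => -[z /middle_thirds_itv]; lra.
rewrite exprS => xy.
have [[u Mu xE]|[u Mu xE]] := middle_thirdsP Mx;
  have [[v Mv yE]|[v Mv yE]] := middle_thirdsP My; subst x y;
  have u01 := middle_thirds_itv Mu; have v01 := middle_thirds_itv Mv.
- have [|z zuv Mz] := IHn u v Mu Mv; first by lra.
  exists (z / 3) => [|/middle_thirdsP]; first lra.
  case=> -[w Mw E]; last by have := middle_thirds_itv Mw; lra.
  by apply: Mz; have -> : z = w by lra.
- by exists (1 / 2) => //; lra.
- have : 0 < (1 / 3 : R) ^+ n by rewrite exprn_gt0 ?divr_gt0.
  lra.
- have [|z zuv Mz] := IHn u v Mu Mv; first by lra.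
  exists ((2 + z) / 3) => [|/middle_thirdsP]; first lra.
  case=> -[w Mw E]; first by have := middle_thirds_itv Mw; lra.
  by apply: Mz; have -> : z = w by lra.
Qed.

Lemma middle_thirds_cantor_space : homeomorphic_sets M [set: cantor_space].
Proof.
have third01 : 0 < (1 / 3 : R) < 1 by lra.
apply: homeomorphic_cantor_space.
- exact: Rhausdorff.
- by exists 0; exact: middle_thirds0.
- exact: middle_thirds_compact.
- move=> x A Mx /nbhs_ballP[e e0 xeA].
  have [n ne] := exprn_lt_eventually third01 e0.
  have [y [My yx xy]] := middle_thirds_neighbour n Mx.
  by exists y; split=> //; apply: xeA; exact: le_lt_trans xy ne.
move=> x y Mx My xy.
suff sep : forall u v, M u -> M v -> u < v -> exists V W : set R,
    [/\ open V, open W, V u, W v & M `<=` V `|` W /\ M `&` V `&` W = set0].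
  have [|yx|/eqP] := ltgtP x y; [exact: sep| |by rewrite (negbTE xy)].
  have [V [W [oV oW Vy Wx [MVW MVW0]]]] := sep _ _ My Mx yx.
  by exists W, V; rewrite setUC setIAC.
move=> u v Mu Mv uv; have [|n ne] := @exprn_lt_eventually _ _ (v - u) third01.
  by rewrite subr_gt0.
have [z /andP[uz zv] Mz] := middle_thirds_gap Mu Mv ne.
exists [set w | w < z], [set w | z < w]; split=> //.
split=> [w Mw /=|].
  by have [|/ltW|E] := ltgtP w z; [left|right|move: Mz; rewrite -E].
apply/seteqP; split=> [w [[_ /=] wz zw]|//]; exfalso; lra.
Qed.

End middle_thirds.

Lemma is_Cantor_set_cantor_space (R : realType) (U : topologicalType) (K : set U) :
  homeomorphic_sets K [set: cantor_space] -> is_Cantor_set R K.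
Proof.
by move=> KC; apply: homeomorphic_sets_trans KC _;
  apply/homeomorphic_sets_sym/middle_thirds_cantor_space.
Qed.

(** * Orbits of an irrational rotation *)

Section rotation.
Context {R : realType} (rho : R).

(** The circle is the fundamental domain [0, 1[; this form of the rotation shows
the two branches that correspond to the branches of a contracted rotation. *)
Definition rot (x : R) : R := if x < 1 - rho then x + rho else x + rho - 1.

Hypothesis rho01 : 0 < rho < 1.

Lemma rot_itv x : 0 <= x < 1 -> 0 <= rot x < 1.
Proof. by move=> x01; rewrite /rot; case: ltP => xr; move: rho01; lra. Qed.

Lemma iter_rot_itv n x : 0 <= x < 1 -> 0 <= iter n rot x < 1.
Proof. by move=> x01; elim: n => //= n IHn; exact: rot_itv. Qed.

Lemma iter_rotE n x : exists m : int, iter n rot x = x + n%:R * rho - m%:~R.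
Proof.
elim: n => [|n [m IHn]] /=; first by exists 0; rewrite mul0r subr0 addr0.
rewrite IHn /rot; case: ltP => _; [exists m|exists (m + 1)].
  by rewrite -addn1 natrD; ring.
by rewrite -addn1 natrD intrD; ring.
Qed.

Lemma eq_of_int_diff (x y : R) (m : int) :
  0 <= x < 1 -> 0 <= y < 1 -> x = y - m%:~R -> x = y.
Proof.
move=> x01 y01 xy; have : (-1)%:~R < m%:~R :> R by rewrite mulrN1z; lra.
have : m%:~R < 1%:~R :> R by rewrite mulr1z; lra.
rewrite !ltr_int => m1 m2; have m0 : m = 0 by lia.
by rewrite xy m0 subr0.
Qed.

Hypothesis irr : irrational rho.

Lemma irrational_mulrn_neq (q : nat) (p : int) : (0 < q)%N ->
  q%:R * rho - p%:~R != 0.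
Proof.
move=> q0; apply/eqP => E; apply: irr; exists (p%:~R / q%:R) => //.
rewrite fmorph_div /= rmorph_int rmorph_nat.
have qn0 : q%:R != 0 :> R by rewrite pnatr_eq0 -lt0n.
apply: (mulIf qn0); rewrite divfK //; lra.
Qed.

(** Each distance d between a multiple of rho and the integers produces one at
most d / 2: among the multiples of d, two consecutive ones enclose 1, and one of
them is at distance at most d / 2 from 1. *)
Lemma small_combination k : exists (q : nat) (p : int),
  (0 < q)%N /\ `|q%:R * rho - p%:~R| <= (1 / 2) ^+ k.
Proof.
elim: k => [|k [q [p [q0 qp]]]].
  exists 1%N, 0; split=> //; move: rho01.
  by rewrite mul1r subr0 expr0 => ?; rewrite ger0_norm//; lra.
set e := q%:R * rho - p%:~R in qp *; set d := `|e| in qp *.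
have d0 : 0 < d by rewrite normr_gt0 irrational_mulrn_neq.
have [s [s1 ed]] : exists s : int, `|s%:~R| = 1 :> R /\ e = s%:~R * d.
  have [e0|e0] := lerP 0 e; [exists 1|exists (-1)].
    by rewrite mulr1z normr1 mul1r /d ger0_norm.
  by rewrite mulrN1z normrN normr1 /d ltr0_norm// mulN1r opprK.
have k1 : (1 / 2) ^+ k <= 1 :> R by apply: exprn_ile1; lra.
have := @truncn_itv _ (d^-1); rewrite invr_ge0 (ltW d0) => /(_ isT).
set n := Num.truncn d^-1.
rewrite -[d^-1]mul1r ler_pdivlMr// ltr_pdivrMr// => /andP[nd1 n1d].
have n0 : (0 < n)%N.
  by rewrite lt0n; apply/eqP => n0; move: n1d; rewrite n0 mul1r; lra.
have E j : (j * q)%N%:R * rho - (j%:R * p%:~R + s%:~R) = s%:~R * (j%:R * d - 1).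
  by rewrite mulrBr mulr1 mulrCA -ed natrM /e; ring.
have P j : exists p', (j * q)%N%:R * rho - p'%:~R = s%:~R * (j%:R * d - 1).
  by exists (j%:Z * p + s); rewrite -E intrD intrM.
have hp : (1 / 2 : R) ^+ k.+1 = (1 / 2) ^+ k / 2 by rewrite exprSr; field.
have [h|h] := lerP (1 - n%:R * d) (d / 2).
  have [p' p'E] := P n; exists (n * q)%N, p'; rewrite muln_gt0 n0 q0.
  by split=> //; rewrite p'E hp normrM s1 ler0_norm; lra.
have [p' p'E] := P n.+1; exists (n.+1 * q)%N, p'; rewrite muln_gt0 q0.
split=> //; rewrite p'E hp normrM s1 gtr0_norm ?subr_gt0//.
by move: h; rewrite -[n.+1]addn1 natrD; lra.
Qed.

(** Only forward iterates are allowed, hence a case for each sign of the small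
displacement: from below the target one moves right, from above it
one moves left. *)
Lemma orbit_mod1_dense (x y e : R) : 0 < e ->
  exists (n : nat) (m : int), y <= x + n%:R * rho - m%:~R < y + e.
Proof.
move=> e0; have half01 : 0 < (1 / 2 : R) < 1 by lra.
have [k ke] := exprn_lt_eventually half01 e0.
have [q [p [q0 qp]]] := small_combination k.
have := irrational_mulrn_neq p q0.
set d := q%:R * rho - p%:~R in qp *; rewrite neq_lt => /orP[d0|d0]; last first.
  rewrite gtr0_norm// in qp.
  set M := Num.ceil (x - y); set z := y - (x - M%:~R).
  have xM : x - M%:~R <= y by have := ceil_ge (x - y); rewrite -/M; lra.
  have z0 : 0 <= z / d by rewrite divr_ge0 ?(ltW d0)//; rewrite /z; lra.
  have /andP[] := truncn_itv z0; set n := Num.truncn _.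
  rewrite ler_pdivlMr// ltr_pdivrMr// => n1 n2.
  exists (n.+1 * q)%N, (M + n.+1%:Z * p).
  have -> : x + (n.+1 * q)%:R * rho - (M + n.+1%:Z * p)%:~R = x - M%:~R + n.+1%:R * d.
    by rewrite intrD intrM natrM /d -[in LHS]mulrA; ring.
  by move: n1 n2; rewrite /z -[n.+1]addn1 natrD; lra.
rewrite ltr0_norm// in qp.
set M := Num.ceil (y - x).
have xM : y <= x + M%:~R by have := ceil_ge (y - x); rewrite -/M; lra.
set z := x + M%:~R - y; have nd0 : 0 < - d by lra.
have z0 : 0 <= z / - d by rewrite divr_ge0 ?(ltW d0)//; rewrite /z; lra.
have /andP[] := truncn_itv z0; set n := Num.truncn _.
rewrite ler_pdivlMr// ltr_pdivrMr// => n1 n2.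
exists (n * q)%N, (n%:Z * p - M).
have -> : x + (n * q)%:R * rho - (n%:Z * p - M)%:~R = x + M%:~R + n%:R * d.
  by rewrite intrB intrM natrM /d; ring.
by move: n1 n2; rewrite /z -[n.+1]addn1 natrD; lra.
Qed.

Lemma iter_rot_dense (x y z : R) : 0 <= x < 1 -> 0 <= y -> y < z -> z <= 1 ->
  exists n, y <= iter n rot x < z.
Proof.
move=> x01 y0 yz z1.
have [|n [m nm]] := @orbit_mod1_dense x y (z - y); first by rewrite subr_gt0.
rewrite subrKC in nm.
exists n; have [m' m'E] := iter_rotE n x.
rewrite (_ : iter n rot x = x + n%:R * rho - m%:~R)//.
apply: (@eq_of_int_diff _ _ (m' - m)); first exact: iter_rot_itv.
  by lra.
by rewrite m'E intrB; ring.
Qed.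

Lemma iter_rot_neq n : iter n rot 0 != 1 - rho.
Proof.
have [m ->] := iter_rotE n 0; rewrite -subr_eq0.
have := @irrational_mulrn_neq n.+1 (1 + m) isT.
by apply: contra => /eqP E; apply/eqP; rewrite -[_.+1]addn1 natrD intrD; lra.
Qed.

Lemma iter_rot_neq0 n : iter n.+1 (rot) 0 != 0.
Proof.
have [m ->] := iter_rotE n.+1 0.
have := @irrational_mulrn_neq n.+1 m isT.
by rewrite add0r.
Qed.

End rotation.

(** * Sums of weights over a set of indices *)

Section weighted_sums.
Context {R : realType} (v : nat -> R).

Definition wsum (b : nat -> bool) : R :=
  limn (series (fun k => v k *+ b k)).

Hypothesis v_gt0 : forall k, 0 < v k.
Hypothesis cvg_v : cvgn (series v).

Lemma is_cvg_wsum (b : nat -> bool) : cvgn (series (fun k => v k *+ b k)).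
Proof.
apply: series_le_cvg cvg_v => k.
- by rewrite mulrn_wge0// ltW.
- exact: ltW.
- by case: (b k) => //=; exact: ltW.
Qed.

Lemma eq_wsum (b b' : nat -> bool) : b =1 b' -> wsum b = wsum b'.
Proof. by move=> bb'; congr wsum; apply/funext. Qed.

Lemma wsum_linear (b b1 b2 : nat -> bool) (x y : R) :
  (forall k, (b k)%:R = x * (b1 k)%:R + y * (b2 k)%:R) ->
  wsum b = x * wsum b1 + y * wsum b2.
Proof.
move=> bE; apply/cvg_lim => //.
have -> : series (fun k => v k *+ b k) = (fun n =>
    x * series (fun k => v k *+ b1 k) n + y * series (fun k => v k *+ b2 k) n).
  apply/funext => n; rewrite /series /= !mulr_sumr -big_split; apply: eq_bigr => i _.
  by rewrite /= -(mulr_natr _ (b i)) -(mulr_natr _ (b1 i)) -(mulr_natr _ (b2 i)) bE; ring.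
by apply: cvgD; apply: cvgMr; exact: is_cvg_wsum.
Qed.

Lemma wsum_split (b b1 b2 : nat -> bool) :
  (forall k, (b k : nat) = b1 k + b2 k)%N -> wsum b = wsum b1 + wsum b2.
Proof.
move=> bE; rewrite -[wsum b1]mul1r -[wsum b2]mul1r; apply: wsum_linear => k.
by rewrite bE natrD !mul1r.
Qed.

Lemma wsum_partial_le (b : nat -> bool) n : \sum_(0 <= k < n) v k *+ b k <= wsum b.
Proof.
apply: (@nondecreasing_cvgn_le _ (series (fun k => v k *+ b k))).
  by apply: nondecreasing_series => k _ _; rewrite mulrn_wge0// ltW.
exact: is_cvg_wsum.
Qed.

Lemma wsum_ge0 (b : nat -> bool) : 0 <= wsum b.
Proof. by have := wsum_partial_le b 0; rewrite big_geq. Qed.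

Lemma le_wsum (b b' : nat -> bool) : (forall k, b k -> b' k) -> wsum b <= wsum b'.
Proof.
move=> bb'; rewrite (@wsum_split b' b (fun k => b' k && ~~ b k)).
  by rewrite lerDl wsum_ge0.
by move=> k; have := bb' k; case: (b k); case: (b' k) => //= /(_ isT).
Qed.

Lemma wsum_ge (b : nat -> bool) k : b k -> v k <= wsum b.
Proof.
move=> bk; apply: le_trans (wsum_partial_le b k.+1).
rewrite big_nat_recr//= bk mulr1n lerDr sumr_ge0// => i _.
by rewrite mulrn_wge0// ltW.
Qed.

Lemma wsum_false (b : nat -> bool) : (forall k, ~~ b k) -> wsum b = 0.
Proof.
move=> b0; rewrite (@wsum_linear b b b 0 0) ?mul0r ?addr0// => k.
by rewrite !mul0r (negbTE (b0 k)) addr0.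
Qed.

(** The remainder of the series, uniformly in the set of indices: a set without
small indices has a small weight. *)
Lemma wsum_tail (e : R) : 0 < e ->
  exists N, forall b : nat -> bool, (forall k, (k < N)%N -> ~~ b k) -> wsum b < e.
Proof.
move=> e0; have cT := @is_cvg_wsum xpredT.
have /cvgrPdist_lt/(_ _ e0)[N _ /(_ N (leqnn N)) /= h] :
  series (fun k => v k *+ xpredT k) @ \oo --> wsum xpredT := cT.
exists N => b bN; apply: le_lt_trans h; apply: le_trans (ler_norm _).
have -> : wsum b = wsum xpredT - wsum (fun k => ~~ b k).
  rewrite (@wsum_split xpredT b (fun k => ~~ b k)) ?addrK// => k.
  by case: (b k).
rewrite lerB//; apply: le_trans (wsum_partial_le _ N).
rewrite /series /= !big_mkord; apply: ler_sum => i _.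
by rewrite bN.
Qed.

(** Shifting the indices by one, when the shifted terms are given by the original
ones on two sets of indices. *)
Lemma wsum_recl (b b1 b2 : nat -> bool) (x y : R) :
  (forall k, v k.+1 *+ b k.+1 = x * (v k *+ b1 k) + y * (v k *+ b2 k)) ->
  wsum b = v 0%N *+ b 0%N + x * wsum b1 + y * wsum b2.
Proof.
move=> bE; apply/cvg_lim => //.
rewrite -cvg_shiftS /=.
have -> : (fun n => series (fun k => v k *+ b k) n.+1) =
  (fun n => v 0%N *+ b 0%N + x * series (fun k => v k *+ b1 k) n
            + y * series (fun k => v k *+ b2 k) n).
  apply/funext => n; rewrite /series /= big_nat_recl//= -addrA; congr (_ + _).
  by rewrite !mulr_sumr -big_split; apply: eq_bigr => i _; exact: bE.
by apply: cvgD; [apply: cvgD; [exact: cvg_cst|]|]; apply: cvgMr;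
  exact: is_cvg_wsum.
Qed.

End weighted_sums.

(** * Contracted rotations with an irrational rotation number *)

Lemma finite_gap_right {R : realType} (y : nat -> R) (x : R) N :
  exists2 d, 0 < d & forall k, (k < N)%N -> x < y k -> x + d <= y k.
Proof.
elim: N => [|N [d d0 dN]]; first by exists 1.
have [xy|xy] := ltP x (y N); last first.
  by exists d => // k; rewrite ltnS leq_eqVlt => /predU1P[->|/dN//]; rewrite ltNge xy.
exists (Num.min d (y N - x)); first by rewrite lt_min d0 subr_gt0.
move=> k; rewrite ltnS leq_eqVlt => /predU1P[->|/dN h] xk.
  by rewrite -lerBrDl ge_min lexx orbT.
by apply: le_trans (h xk); rewrite lerD2l ge_min lexx.
Qed.

Lemma finite_gap_left {R : realType} (y : nat -> R) (x : R) N :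
  exists2 d, 0 < d & forall k, (k < N)%N -> y k < x -> y k <= x - d.
Proof.
have [d d0 h] := finite_gap_right (fun k => - y k) (- x) N.
exists d => // k /h; rewrite ltrN2 => {}h /h; lra.
Qed.

Section denjoy.
Context {R : realType} (len kL kR : R).
Hypotheses (len0 : 0 < len) (kR0 : 0 < kR) (kRL : kR <= kL) (kL1 : kL < 1).

(** On the circle obtained by gluing 0 to - len, this is continuous at c; its jump
is at the glued point. *)
Definition contracted_rotation (c s : R) : R :=
  if s < c then kL * (s - c) else - len + kR * (s - c).

Section parametrization.
Context (rho : R).
Local Notation rot := (rot rho).

Definition orb k : R := iter k.+1 rot 0.

(** Up to a factor, the length of the gap labelled by the k-th orbit point: each
gap is the image of the previous one, by the branch on whose side it lies. *)
Fixpoint weight k : R :=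
  if k is j.+1 then (if orb j < 1 - rho then kL else kR) * weight j else 1.

Definition total : R := wsum weight xpredT.
Definition total_left : R := wsum weight (fun k => orb k < 1 - rho).
Definition total_right : R := wsum weight (fun k => 1 - rho <= orb k).

(** Normalized so that the gaps fill the interval [- len, 0]. *)
Definition phi (x : R) : R :=
  - len + len / total * wsum weight (fun k => orb k <= x).

Definition cut : R := phi (1 - rho).

Hypotheses (rho01 : 0 < rho < 1) (irr : irrational rho).

Let z01 : 0 <= (0 : R) < 1. Proof. by rewrite lexx ltr01. Qed.

Lemma orb0 : orb 0 = rho.
Proof. by rewrite /orb /= /rot add0r subr_gt0; case/andP: rho01 => _ ->. Qed.

Lemma orbS k : orb k.+1 = rot (orb k). Proof. by []. Qed.

Lemma orb_itv k : 0 < orb k < 1.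
Proof.
have := iter_rot_itv rho01 k.+1 z01; rewrite -/(orb k) => /andP[pos ->].
by rewrite andbT lt_neqAle pos eq_sym andbT iter_rot_neq0.
Qed.

Lemma orb_neq k : orb k != 1 - rho.
Proof. exact: iter_rot_neq. Qed.

Let kL0 : 0 < kL. Proof. exact: lt_le_trans kRL. Qed.

Lemma weight_gt0 k : 0 < weight k.
Proof. by elim: k => //= k IHk; rewrite mulr_gt0//; case: ifP. Qed.

Lemma weight_le k : weight k <= kL ^+ k.
Proof.
elim: k => //= k IHk; rewrite exprS ler_pM//.
- by case: ifP => _; exact: ltW.
- exact/ltW/weight_gt0.
- by case: ifP.
Qed.

Lemma is_cvg_weight : cvgn (series weight).
Proof.
apply: (@series_le_cvg _ weight (geometric 1 kL)).
- by move=> k; exact/ltW/weight_gt0.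
- by move=> k; rewrite /geometric /= mul1r exprn_ge0 ?ltW.
- by move=> k; rewrite /geometric /= mul1r weight_le.
- by apply: is_cvg_geometric_series; rewrite gtr0_norm.
Qed.

Let W := @weight_gt0.
Let C := is_cvg_weight.

Lemma total_gt0 : 0 < total.
Proof. exact: lt_le_trans (W 0) (wsum_ge W C _). Qed.

Lemma totalE : total = total_left + total_right.
Proof.
by apply: wsum_split => // k; case: ltP.
Qed.

(** The gaps other than the first one are the images of all the gaps. *)
Lemma total_recl : total = 1 + kL * total_left + kR * total_right.
Proof.
rewrite {1}/total (@wsum_recl _ _ W C _ (fun k => orb k < 1 - rho)
  (fun k => 1 - rho <= orb k) kL kR) // => k /=.
by case: ltP => _ /=; rewrite ?mulr1n ?mulr0n ?mulr0 ?addr0 ?add0r.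
Qed.

Lemma scale_gt0 : 0 < len / total.
Proof. by rewrite divr_gt0 ?total_gt0. Qed.

Lemma le_phi x y : x <= y -> phi x <= phi y.
Proof.
move=> xy; rewrite lerD2l ler_pM2l ?scale_gt0// le_wsum// => k kx.
exact: le_trans xy.
Qed.

Lemma phi0 : phi 0 = - len.
Proof.
rewrite /phi wsum_false// ?mulr0 ?addr0// => k.
by rewrite -ltNge; case/andP: (orb_itv k).
Qed.

Lemma phi1 : phi 1 = 0.
Proof.
rewrite /phi (@eq_wsum _ _ _ xpredT) => [|k].
  by rewrite -/total divfK ?addNr// gt_eqF ?total_gt0.
by rewrite ltW//; case/andP: (orb_itv k).
Qed.

Lemma phi_ge x : - len <= phi x.
Proof. by rewrite /phi lerDl mulr_ge0 ?wsum_ge0// ltW ?scale_gt0. Qed.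

Lemma phi_jump x y k : x < orb k -> orb k <= y ->
  phi x + len / total * weight k <= phi y.
Proof.
move=> xk ky; rewrite /phi -addrA lerD2l -mulrDr ler_pM2l ?scale_gt0//.
rewrite (@wsum_split _ _ W C (fun j => orb j <= y) (fun j => orb j <= x)
  (fun j => x < orb j <= y)); last first.
  move=> j; case: leP => jx /=; last by rewrite add0n.
  by rewrite (le_trans jx)// (le_trans (ltW xk)).
by rewrite lerD2l wsum_ge// xk ky.
Qed.

Lemma orb_dense x y : 0 <= x -> x < y -> y <= 1 -> exists k, x < orb k < y.
Proof.
move=> x0 xy y1; have rho1 : 0 <= rho < 1 by move: rho01; lra.
have [|||n] := @iter_rot_dense _ _ rho01 irr rho ((x + y) / 2) y rho1; try lra.
have <- : orb n = iter n rot rho.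
  by rewrite /orb iterSr; congr (iter _ _ _); exact: orb0.
by move=> nxy; exists n; lra.
Qed.

Lemma lt_phi x y : 0 <= x -> x < y -> y <= 1 -> phi x < phi y.
Proof.
move=> x0 xy y1; have [k /andP[xk /ltW ky]] := orb_dense x0 xy y1.
apply: lt_le_trans (phi_jump xk ky).
by rewrite ltrDl mulr_gt0 ?scale_gt0.
Qed.

Lemma phi_lt0 x : 0 <= x < 1 -> phi x < 0.
Proof. by move=> /andP[x0 x1]; rewrite -phi1 lt_phi. Qed.

Lemma phi_sub x y : x <= y ->
  phi y - phi x = len / total * wsum weight (fun k => x < orb k <= y).
Proof.
move=> xy; rewrite /phi (@wsum_split _ _ W C (fun j => orb j <= y)
  (fun j => orb j <= x) (fun j => x < orb j <= y)); first by ring.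
move=> j; case: leP => jx /=; last by rewrite add0n.
by rewrite (le_trans jx).
Qed.

(** A short interval to the right of x contains no orbit point of small index, so
that its jumps are small. *)
Lemma phi_right_cont x e : 0 < e ->
  exists2 d, 0 < d & forall y, y < x + d -> phi y < phi x + e.
Proof.
move=> e0; have e1 : 0 < e / (len / total) by rewrite divr_gt0 ?scale_gt0.
have [N Ne] := wsum_tail W C e1; have [d d0 dN] := finite_gap_right orb x N.
exists d => // y yd; have [yx|xy] := leP y x.
  by apply: le_lt_trans (le_phi yx) _; rewrite ltrDl.
rewrite -ltrBlDl phi_sub ?(ltW xy)// mulrC -ltr_pdivlMr ?scale_gt0// Ne// => k kN.
apply/negP => /andP[/(dN k kN) h1 h2]; lra.
Qed.

Lemma phi_left_cont x e : (forall k, orb k != x) -> 0 < e ->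
  exists2 d, 0 < d & forall y, x - d < y -> phi x - e < phi y.
Proof.
move=> ox e0; have e1 : 0 < e / (len / total) by rewrite divr_gt0 ?scale_gt0.
have [N Ne] := wsum_tail W C e1; have [d d0 dN] := finite_gap_left orb x N.
exists d => // y yd; have [xy|yx] := leP x y.
  by apply: lt_le_trans (le_phi xy); rewrite ltrBlDr ltrDl.
rewrite ltrBlDr -ltrBlDl phi_sub ?(ltW yx)// mulrC -ltr_pdivlMr ?scale_gt0// Ne// => k kN.
apply/negP => /andP[h1]; rewrite le_eqVlt (negbTE (ox k)) => /(dN k kN) h2; lra.
Qed.

Lemma phi_sub_cut x : phi x - cut =
  len / total * (wsum weight (fun k => orb k <= x) - total_left).
Proof.
rewrite /cut /phi (@eq_wsum _ _ (fun k => orb k <= 1 - rho)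
  (fun k => orb k < 1 - rho)) => [|k]; first by rewrite /total_left; ring.
by rewrite le_eqVlt (negbTE (orb_neq k)).
Qed.

(** The semiconjugacy. The rotation maps the k-th orbit point to the next one and
multiplies the jump there by kL or kR, so on either branch [phi (rot x)] is an
affine function of [phi x]; the constant terms agree by [total_recl]. *)
Lemma phi_rot x : 0 <= x < 1 -> phi (rot x) = contracted_rotation cut (phi x).
Proof.
move=> x01; have tn0 : total != 0 by rewrite gt_eqF ?total_gt0.
have TR := total_recl; have T := totalE.
have oS k : weight k.+1 = (if orb k < 1 - rho then kL else kR) * weight k by [].
rewrite /contracted_rotation; have [xr|xr] := ltP x (1 - rho).
  rewrite (lt_phi (y := 1 - rho)); first last; try by move: x01 rho01; lra.
  rewrite phi_sub_cut /phi /rot xr.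
  rewrite (@wsum_recl _ _ W C (fun k => orb k <= x + rho) (fun k => orb k <= x)
    (fun k => 1 - rho <= orb k) kL kR) => [|k].
    rewrite -/total_right orb0 lerDr; case/andP: x01 => -> _ /=; rewrite mulr1n.
    have -> : - len = len / total * - (1 + kL * total_left + kR * total_right).
      by rewrite -TR; field.
    by ring.
  rewrite oS orbS /rot; case: ltP => kr.
    by rewrite lerD2r /= mulr0n mulr0 addr0 mulrnAr.
  have /andP[_ k1] := orb_itv k.
  have -> : (orb k + rho - 1 <= x + rho) by move: x01; lra.
  have -> : (orb k <= x) = false by apply/negbTE; rewrite -ltNge; lra.
  by rewrite /= mulr0n mulr0 add0r.
rewrite ltNge le_phi//=.
rewrite phi_sub_cut /phi /rot ltNge xr /=; congr (_ + _).
rewrite (@wsum_split _ _ W C (fun k => orb k <= x) (fun k => orb k < 1 - rho)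
  (fun k => 1 - rho <= orb k <= x)) => [|k]; last first.
  by case: ltP => //= kr; rewrite (le_trans (ltW kr)).
rewrite -/total_left [X in _ = _ * (_ * X)]addrC addKr mulrCA; congr (_ * _).
rewrite (@wsum_recl _ _ W C (fun k => orb k <= x + rho - 1) xpred0
  (fun k => 1 - rho <= orb k <= x) 0 kR) => [|k].
  rewrite orb0 mul0r addr0; have -> : (rho <= x + rho - 1) = false.
    by apply/negbTE; rewrite -ltNge; move: x01; lra.
  by rewrite add0r.
rewrite oS orbS /rot mul0r add0r; have /andP[k0 k1] := orb_itv k; case: ltP => kr /=.
  rewrite mulr0n mulr0 (_ : (orb k + rho <= x + rho - 1) = false)//.
  by apply/negbTE; rewrite -ltNge; move: x01; lra.
by rewrite mulrnAr; congr (_ *+ nat_of_bool _); apply/idP/idP; lra.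
Qed.

Lemma cut_itv : - len <= cut < 0.
Proof. by rewrite /cut phi_ge phi_lt0//; apply/andP; move: rho01; split; lra. Qed.

(** If rho > 1/2, the first gap lies to the right of the cut, and the following
ones are too small for the gaps on the left to compete. *)
Lemma cut_le : 1 / 2 < rho -> cut <= - (len * (1 - kL) / (1 - kL + kR)).
Proof.
move=> rho2; have := phi_sub_cut 1; rewrite phi1 sub0r.
rewrite (@eq_wsum _ _ _ xpredT) => [|k]; last first.
  by rewrite ltW//; case/andP: (orb_itv k).
rewrite -/total {2}totalE addrC addKr => /(congr1 -%R); rewrite opprK => ->.
have p0 : 0 < 1 - kL + kR by move: kL1 kR0; lra.
have R1 : 1 <= total_right.
  by apply: (wsum_ge W C (k := 0%N)) => /=; rewrite orb0; lra.
have TR := total_recl; have T := totalE.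
rewrite lerN2 -mulrA -[leRHS]mulrA ler_pM2l// ler_pdivrMr//.
rewrite [total^-1 * _]mulrC mulrAC ler_pdivlMr ?total_gt0//.
have : (1 - kL) * total_left <= kR * total_right by nra.
rewrite T; nra.
Qed.

(** An interval that meets the range of [phi] contains values at two points of
the circle, thus a whole jump, because the orbit is dense. *)
Lemma phi_range_gap u v : u < v ->
  exists2 z, u < z < v & exists2 e, 0 < e &
    forall x, 0 <= x < 1 -> e <= `|phi x - z|.
Proof.
move=> uv.
have [[x [x01 /andP[ux xv]]]|nx] :=
  pselect (exists x, 0 <= x < 1 /\ u < phi x < v); last first.
  exists ((u + v) / 2); first lra.
  exists ((v - u) / 2) => [|x x01]; first lra.
  have [xu|ux] := leP (phi x) u; first by rewrite ler0_norm; lra.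
  have [vx|xv] := leP v (phi x); first by rewrite ger0_norm; lra.
  by exfalso; apply: nx; exists x; rewrite ux xv.
have [|d d0 xd] := @phi_right_cont x (v - phi x); first by rewrite subr_gt0.
have [x0 x1] := andP x01.
set y := Num.min (x + d / 2) 1.
have xy : x < y by rewrite lt_min x1 andbT; lra.
have y1 : y <= 1 by rewrite ge_min lexx orbT.
have yd : y < x + d by rewrite gt_min; apply/orP; left; lra.
have [k /andP[xk ky]] := orb_dense x0 xy y1.
have j0 : 0 < len / total * weight k by rewrite mulr_gt0 ?scale_gt0.
set j := len / total * weight k in j0.
have kv : phi (orb k) < v by have := xd _ (lt_trans ky yd); lra.
have jmp x' : x' < orb k -> phi x' + j <= phi (orb k).
  by move=> x'k; exact: phi_jump.
exists (phi (orb k) - j / 2); first by have := jmp _ xk; lra.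
exists (j / 2) => [|x' _]; first lra.
have [kx'|x'k] := leP (orb k) x'.
  by have h := le_phi kx'; rewrite ger0_norm; lra.
by have h := jmp _ x'k; rewrite ler0_norm; lra.
Qed.

(** The abscissa s belongs to the closed gap labelled by x, namely the interval
from the left limit of [phi] at x to [phi x]. *)
Definition follows (x s : R) : Prop :=
  [/\ 0 <= x < 1, - len <= s, s <= phi x & forall y, 0 <= y < x -> phi y <= s].

Lemma exists_follows s : - len <= s < 0 -> exists x, follows x s.
Proof.
move=> /andP[sl s0]; pose E := [set y | 0 <= y < 1 /\ s <= phi y].
have o1 k : orb k != 1 by rewrite lt_eqF//; case/andP: (orb_itv k).
have [|d d0 sd] := phi_left_cont o1 (e := - s); first lra.
have [y Ey] : E !=set0.
  exists (Num.max 0 (1 - d / 2)); split.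
    rewrite le_max lexx /= gt_max ltr01 /=; lra.
  have /sd : 1 - d < Num.max 0 (1 - d / 2) by rewrite lt_max; apply/orP; right; lra.
  by rewrite phi1; lra.
have lbE : lbound E 0 by move=> ? [/andP[]].
have hE : has_inf E by split; [exists y|exists 0].
have x0 : 0 <= inf E by apply: lb_le_inf => //; exists y.
have x1 : inf E < 1.
  apply: le_lt_trans (ge_inf _ Ey) _; first by exists 0.
  by case: Ey => /andP[].
exists (inf E); split=> //; first by rewrite x0.
  rewrite leNgt; apply/negP => xs.
  have [|e e0 xe] := @phi_right_cont (inf E) (s - phi (inf E)); first by rewrite subr_gt0.
  have [z [_ sz] zE] := inf_adherent e0 hE.
  by have := xe _ zE; rewrite subrKC ltNge sz.
move=> z /andP[z0 zx]; rewrite leNgt; apply/negP => sz.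
have : E z by split; [rewrite z0 (lt_trans zx)|exact: ltW].
by move=> /(ge_inf (ex_intro _ 0 lbE)); rewrite leNgt zx.
Qed.

(** [phi] is continuous at 1 - rho, which is not a point of the orbit; hence the
gap labelled by 1 - rho reduces to the cut, and no other gap crosses it. *)
Lemma follows_side x s : follows x s -> s != cut -> (s < cut) = (x < 1 - rho).
Proof.
move=> [x01 _ sx xs] sc; have [xr|] := ltP x (1 - rho).
  by apply: le_lt_trans sx _; rewrite lt_phi//; move: x01 rho01; lra.
rewrite le_eqVlt => /predU1P[xr|rx]; last first.
  apply/negbTE; rewrite -leNgt; apply: xs; move: x01 rho01; lra.
apply/negbTE; rewrite -leNgt leNgt; apply/negP => {}sc.
have [|d d0 cd] := phi_left_cont (x := 1 - rho) orb_neq (e := cut - s).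
  by rewrite subr_gt0.
have r0 : 0 < 1 - rho by move: rho01; lra.
set y := Num.max 0 (1 - rho - d / 2).
have /cd : 1 - rho - d < y by rewrite lt_max; apply/orP; right; lra.
have /xs : 0 <= y < x by rewrite -xr le_max lexx /= gt_max r0 /=; lra.
by rewrite /cut; lra.
Qed.

(** Labels follow the rotation while the distance to [phi] of the label shrinks:
both abscissas lie on the same side of the cut, so one affine branch applies. *)
Lemma follows_step x s : follows x s -> s != cut ->
  follows (rot x) (contracted_rotation cut s) /\
  `|contracted_rotation cut s - phi (rot x)| <= kL * `|s - phi x|.
Proof.
move=> fx sc; have side := follows_side fx sc; have [x01 ls sx xs] := fx.
have rx01 := rot_itv rho01 x01; have := phi_rot x01.
have kn : `|kL| = kL by rewrite gtr0_norm.
have [c0 c1] := andP cut_itv.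
rewrite /contracted_rotation side; have [xr|xr] := ltP x (1 - rho).
  have -> : phi x < cut by rewrite lt_phi//; move: x01 rho01; lra.
  move=> E; split; last first.
    rewrite E (_ : _ - _ = kL * (s - phi x)); last by ring.
    by rewrite normrM kn.
  have P0 : phi (rot 0) = kL * (- len - cut).
    by have := phi_rot z01; rewrite phi0 /contracted_rotation lt_neqAle c0 andbT
      -phi0 lt_eqF// ?lt_phi//; move: rho01; lra.
  have le0 : phi (rot 0) <= kL * (s - cut) by rewrite P0 ler_pM2l// lerD2r.
  split=> //.
  - exact: le_trans (phi_ge _) le0.
  - by rewrite E ler_pM2l// lerD2r.
  move=> y /andP[y0 yx]; have [yr|ry] := ltP y rho.
    apply: le_trans le0; rewrite le_phi// /rot subr_gt0 add0r.
    by case/andP: rho01 => _ ->; exact: ltW.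
  move: yx; rewrite {1}/rot xr -ltrBlDr => yx.
  have yx' : 0 <= y - rho < x by rewrite yx andbT subr_ge0.
  have := @phi_rot (y - rho); rewrite /contracted_rotation /rot.
  have yr : y - rho < 1 - rho by apply: lt_trans xr.
  rewrite yr subrK => ->; last by move: yx' x01; lra.
  rewrite ifT ?ler_pM2l ?lerD2r ?xs// lt_phi//; move: x01 yx' rho01; lra.
have cx : (phi x < cut) = false by apply/negbTE; rewrite -leNgt le_phi.
have cs : cut <= s by rewrite leNgt side -leNgt.
rewrite cx => E; split; last first.
  rewrite E (_ : _ - _ = kR * (s - phi x)); last by ring.
  by rewrite normrM gtr0_norm// ler_wpM2r.
split=> //.
- by rewrite lerDl mulr_ge0 ?subr_ge0// ltW.
- by rewrite E lerD2l ler_pM2l// lerD2r.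
move=> y; rewrite {1}/rot [x < _]ltNge xr /= => /andP[y0 yx].
have [y'0 y'x] : 1 - rho <= y - rho + 1 /\ y - rho + 1 < x by move: y0 yx; lra.
have y'01 : 0 <= y - rho + 1 < 1 by move: x01 y'0 y'x rho01; lra.
have := phi_rot y'01; rewrite /contracted_rotation /rot [_ < 1 - rho]ltNge y'0 /=.
have -> : y - rho + 1 + rho - 1 = y by ring.
rewrite ltNge le_phi//= => ->; rewrite lerD2l ler_pM2l// lerD2r xs//.
by rewrite y'x andbT; case/andP: y'01.
Qed.

End parametrization.

(** The cut determines the map, hence the itinerary of - len, which is the value
of [phi] at 0; and the itinerary counts the turns of the orbit of 0 under the
rotation, that is, the integer parts of n rho. Two rotations with the same
counts differ by less than 1 / n for each n. *)
Lemma cut_inj (rho rho' : R) : 0 < rho < 1 -> 0 < rho' < 1 ->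
  irrational rho -> irrational rho' -> cut rho = cut rho' -> rho = rho'.
Proof.
move=> r01 r01' ir ir' cc.
have z01 : 0 <= (0 : R) < 1 by rewrite lexx ltr01.
have side r (h : 0 < r < 1) (i : irrational r) x : 0 <= x < 1 ->
    (phi r x < cut r) = (x < 1 - r).
  move=> x01; have [xr|rx] := ltP x (1 - r); last first.
    by apply/negbTE; rewrite -leNgt; exact: le_phi.
  by rewrite lt_phi//; move: x01 h; lra.
have P n : phi rho (iter n (rot rho) 0) = phi rho' (iter n (rot rho') 0).
  elim: n => [|n IHn]; first by rewrite /= !phi0.
  by rewrite !iterS !phi_rot ?IHn ?cc//; apply: iter_rot_itv.
have M n : exists m : int, iter n (rot rho) 0 = n%:R * rho - m%:~R /\
    iter n (rot rho') 0 = n%:R * rho' - m%:~R.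
  elim: n => [|n [m [IH IH']]]; first by exists 0; rewrite /= !mul0r subr0.
  have := side _ r01 ir _ (iter_rot_itv r01 n z01).
  rewrite P cc side ?iter_rot_itv// !iterS => E.
  rewrite /rot -/(rot rho) -/(rot rho') E; case: ltP => _; rewrite IH IH'.
    by exists m; rewrite -[n.+1]addn1 natrD; split; ring.
  by exists (m + 1); rewrite -[n.+1]addn1 natrD intrD; split; ring.
apply: contrapT => /eqP; rewrite -subr_eq0 -normr_gt0; set d := `|_| => d0.
have i0 : 0 <= d^-1 by rewrite invr_ge0 ltW.
have /andP[_] := truncn_itv i0; set n := _.+1 => nd.
have [m [E E']] := M n.
have := iter_rot_itv r01 n z01; have := iter_rot_itv r01' n z01.
rewrite E E' => h' h; have : `|n%:R * (rho - rho')| < 1.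
  by rewrite ltr_norml; move: h h'; lra.
rewrite normrM -/d ger0_norm ?ler0n// ltNge => /negP; apply.
by rewrite -ler_pdivrMr// mul1r ltW.
Qed.

End denjoy.

(** * Excursions of the outer billiard map *)

Section outer_billiard_step.
Context {R : realType}.

(** A barycentre lies on the left of a ray as soon as the vertices do. *)
Lemma cross_sum (n : nat) (u x : R * R) (t : 'I_n -> R) (p : 'I_n -> R * R) :
  \sum_i t i = 1 ->
  cross u (\sum_i t i *: p i - x) = \sum_i t i * cross u (p i - x).
Proof.
move=> t1; have sum1 : (\sum_i t i *: p i).1 = \sum_i t i * (p i).1.
  by rewrite (big_morph fst (id1 := 0) (op1 := +%R)).
have sum2 : (\sum_i t i *: p i).2 = \sum_i t i * (p i).2.
  by rewrite (big_morph snd (id1 := 0) (op1 := +%R)).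
rewrite /cross /= sum1 sum2.
have -> : u.1 * (\sum_i t i * (p i).2 - x.2) - u.2 * (\sum_i t i * (p i).1 - x.1) =
    \sum_i t i * (u.1 * (p i).2 - u.2 * (p i).1)
    - \sum_i t i * (u.1 * x.2 - u.2 * x.1).
  rewrite -mulr_suml t1 mul1r !mulrBr !mulr_sumr.
  have -> : \sum_i t i * (u.1 * (p i).2 - u.2 * (p i).1) =
     \sum_i u.1 * (t i * (p i).2) - \sum_i u.2 * (t i * (p i).1).
    by rewrite -sumrB; apply: eq_bigr => i _; ring.
  by ring.
by rewrite -sumrB; apply: eq_bigr => i _; ring.
Qed.

Lemma outer_billiard_vertex (lam : R) n (A : n.-tuple (R * R)) (x v : R * R) :
  v \in A -> (forall w, w \in A -> w != v -> 0 < cross (v - x) (w - x)) ->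
  outer_billiard lam A x = (1 + lam) *: v - lam *: x.
Proof.
move=> vA vpos; rewrite /outer_billiard; congr (_ *: _ - _).
have cvv (u : R * R) : cross u u = 0 by rewrite /cross mulrC subrr.
have lv : left_vertices A x v.
  split=> // p [t [t0 t1 ->]]; rewrite cross_sum// sumr_ge0// => i _.
  rewrite mulr_ge0//; have [->|wv] := eqVneq (tnth A i) v; first by rewrite cvv.
  exact/ltW/vpos/wv/mem_tnth.
have [wA lw] := @xgetPex _ 0 (left_vertices A x) (ex_intro _ v lv).
apply/eqP/negPn/negP => wv; have := vpos _ wA wv.
have : polygon A v.
  have /tnthP[i vi] := vA; exists (fun j => (j == i)%:R); split=> [j||].
  - by rewrite ler0n.
  - by rewrite (bigD1 i)//= eqxx big1 ?addr0// => j /negbTE ->.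
  - rewrite (bigD1 i)//= eqxx scale1r big1 ?addr0 -?vi// => j /negbTE ->.
    by rewrite scale0r.
by move=> /lw; rewrite /cross; set a := xget _ _; lra.
Qed.

End outer_billiard_step.

(** The slopes are (4/5)^4 and (4/5)^6: each turn multiplies lengths by 4/5, and
an excursion takes four or six turns. *)
Definition return_len {R : realType} : R := 36 / 25.
Definition rate_left {R : realType} : R := 256 / 625.
Definition rate_right {R : realType} : R := (64 / 125) ^+ 2.
Definition return_rate {R : realType} (left : bool) : R :=
  if left then rate_left else rate_right.
Definition return_time (left : bool) : nat := if left then 4 else 6.

Lemma return_time_gt0 b : (0 < return_time b)%N.
Proof. by case: b. Qed.

Section quadrilateral.
Context {R : realType} (a : R).
Hypothesis a36 : 3 / 10 <= a <= 6 / 10.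

Let a3 : 3 / 10 <= a. Proof. by case/andP: a36. Qed.
Let a6 : a <= 6 / 10. Proof. by case/andP: a36. Qed.

Local Notation T := (outer_billiard (4 / 5) (quad a)).

Lemma quad_step (v x y : R * R) :
  v \in (quad a : seq _) ->
  all (fun w => (w == v) || (0 < cross (v - x) (w - x))) (quad a) ->
  y = (9 / 5 * v.1 - 4 / 5 * x.1, 9 / 5 * v.2 - 4 / 5 * x.2) -> T x = y.
Proof.
move=> vA /allP h ->; rewrite (@outer_billiard_vertex _ _ _ _ _ v)//.
  by congr pair; rewrite /= /GRing.scale /=; field.
by move=> w /h /predU1P[->|//]; rewrite eqxx.
Qed.

Lemma step_D s h : s < 0 -> -1 <= h ->
  T (s, 1 + h) = (- (4 / 5) * s, - (4 / 5) * (1 + h)).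
Proof.
move=> s0 h1; apply: (@quad_step (0, 0)).
- by rewrite !inE eqxx !orbT.
- rewrite /= eqxx /cross /= andbT; apply/and3P.
  split; apply/orP; right; move: a3 a6 => *; nra.
- by congr pair => /=; field.
Qed.

Lemma step_C s h : s < 0 -> -1 < h < 1 ->
  0 < 9 / 5 - a + 16 / 25 * s + 4 / 5 * h * (1 - a) ->
  T (- (4 / 5) * s, - (4 / 5) * (1 + h)) =
  (9 / 5 + 16 / 25 * s, 1 + 16 / 25 * h).
Proof.
move=> s0 /andP[h0 h1] sh; apply: (@quad_step (1, 1 / 5)).
- by rewrite !inE eqxx !orbT.
- rewrite /= eqxx /cross /= andbT; apply/and3P.
  split; apply/orP; right; move: a3 a6 => *; nra.
- by congr pair => /=; field.
Qed.

Lemma step_A x h : 0 < x -> 0 < h ->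
  T (x, 1 + h) = (- (4 / 5) * x, 1 - 4 / 5 * h).
Proof.
move=> x0 h0; apply: (@quad_step (0, 1)).
- by rewrite !inE eqxx.
- rewrite /= eqxx /cross /= andbT; apply/and3P.
  split; apply/orP; right; move: a3 a6 => *; nra.
- by congr pair => /=; field.
Qed.

Lemma step_B x h : a < x -> -1 < h < 0 -> 0 < 4 / 5 * (x - a) + h * (1 - a) ->
  T (x, 1 + h) = (9 / 5 * a - 4 / 5 * x, 1 - 4 / 5 * h).
Proof.
move=> x0 /andP[h1 h0] xh; apply: (@quad_step (a, 1)).
- by rewrite !inE eqxx orbT.
- rewrite /= eqxx /cross /= andbT; apply/and3P.
  split; apply/orP; right; move: a3 a6 => *; nra.
- by congr pair => /=; field.
Qed.

Lemma singular_DA y : 0 <= y -> singular_set (quad a) (0, y).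
Proof.
move=> y0; exists (inord 3) => //; rewrite /ray /=; exists y => //=.
by rewrite !(tnth_nth 0) /= inordK//=; congr pair => /=; rewrite /GRing.scale /=; ring.
Qed.

Lemma singular_AB x : 0 <= x -> singular_set (quad a) (x, 1).
Proof.
move=> x0; have a0 : 0 < a by move: a3 => ?; lra.
exists (inord 0) => //; rewrite /ray /=.
exists (x / a) => /=; first by rewrite divr_ge0// ltW.
have an0 : a != 0 by rewrite gt_eqF.
by rewrite !(tnth_nth 0) /= inordK//=; congr pair => /=; rewrite /GRing.scale /=; field.
Qed.


(** The abscissa after three turns, whose sign decides how the excursion ends. *)
Definition offset (s : R) : R := 9 / 5 * a - 36 / 25 - 64 / 125 * s.

(** The successive points of an excursion that starts at (s, 1 + h), as affine
functions of s and h; the values for j >= 4 are those of the long excursions. *)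
Definition orbit_point (j : nat) (s h : R) : R * R :=
  match j with
  | 0%N => (s, 1 + h)
  | 1%N => (- (4 / 5) * s, - (4 / 5) * (1 + h))
  | 2%N => (9 / 5 + 16 / 25 * s, 1 + 16 / 25 * h)
  | 3%N => (offset s, 1 - 64 / 125 * h)
  | 4%N => (- (4 / 5) * offset s, - (4 / 5) * (1 - 64 / 125 * h))
  | 5%N => (9 / 5 + 16 / 25 * offset s, 1 - 16 / 25 * (64 / 125 * h))
  | _ => (- (36 / 25) - 64 / 125 * offset s, 1 + (64 / 125) ^+ 2 * h)
  end.

(** The bounds on h and on s are such that the second turn is around C and that
the third one starts far enough to the right of B. *)
Definition in_strip (eps s h : R) : Prop :=
  [/\ 0 < eps < 2 / 5, - rect_length (4 / 5) a + eps <= s < 0 &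
      - eps ^+ 2 <= h < 0].

Lemma rect_lengthE : rect_length (4 / 5) a = 5 / 4 + (1 - a) * (25 / 16).
Proof. by rewrite /rect_length; field. Qed.

Lemma step_C_strip eps s h : 0 < eps < 2 / 5 ->
  - rect_length (4 / 5) a + eps <= s < 0 -> - eps ^+ 2 <= h <= eps ^+ 2 ->
  T (orbit_point 1 s h) = orbit_point 2 s h.
Proof.
rewrite rect_lengthE => /andP[e0 e1] /andP[s1 s0] /andP[h1 h2].
have ee : eps ^+ 2 <= eps * (2 / 5) by rewrite expr2 ler_pM2l// ltW.
have ha : - (7 / 10 * (eps * (2 / 5))) <= h * (1 - a).
  by move: a3 a6 => ? ?; nra.
apply: step_C => //; lra.
Qed.

Lemma orbit_first eps s h j : in_strip eps s h -> (j < 4)%N ->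
  iter j T (s, 1 + h) = orbit_point j s h.
Proof.
case=> e01 s01 /andP[h1 h0].
have h2 : h <= eps ^+ 2 by apply: le_trans (ltW h0) _; exact: sqr_ge0.
have E1 : T (orbit_point 0 s h) = orbit_point 1 s h.
  apply: step_D; first by case/andP: s01.
  by have := e01; nra.
have h12 : - eps ^+ 2 <= h <= eps ^+ 2 by rewrite h1.
have E2 := step_C_strip e01 s01 h12.
have E3 : T (orbit_point 2 s h) = orbit_point 3 s h.
  rewrite /= step_B; first last.
  - move: s01 e01; rewrite rect_lengthE => /andP[s1 s0] /andP[e0 e1].
    have ee : eps ^+ 2 <= eps * (2 / 5) by rewrite expr2 ler_pM2l// ltW.
    have ha : - (7 / 10 * (eps * (2 / 5))) <= h * (1 - a).
      by move: a3 a6 => ? ?; nra.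
    lra.
  - by have := e01; nra.
  - move: s01 e01; rewrite rect_lengthE => /andP[s1 s0] /andP[e0 e1]; lra.
  by congr pair; rewrite /offset; field.
case: j => [|[|[|[|//]]]] _ //=; rewrite -/(orbit_point 0 s h) E1 ?E2 ?E3 //.
Qed.

Lemma orbit_left eps s h : in_strip eps s h -> 0 < offset s ->
  iter 4 T (s, 1 + h) = (- (4 / 5) * offset s, 1 + 256 / 625 * h).
Proof.
move=> sh os; rewrite iterS (orbit_first sh)//=; case: sh => _ _ /andP[_ h0].
have -> : 1 - 64 / 125 * h = 1 + (- (64 / 125) * h) by ring.
have h' : 0 < - (64 / 125) * h by lra.
rewrite step_A//; by congr pair; field.
Qed.

Lemma orbit_right eps s h : in_strip eps s h -> offset s < 0 ->
  (forall j, (j < 7)%N -> iter j T (s, 1 + h) = orbit_point j s h).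
Proof.
move=> sh os; have := orbit_first sh; case: sh => /andP[e0 e1] /andP[s1 s0] /andP[h1 h0] H.
have oe : - rect_length (4 / 5) a + eps <= offset s < 0.
  by rewrite os andbT rect_lengthE /offset; move: a3 a6 => ? ?; lra.
have h' : - eps ^+ 2 <= - (64 / 125) * h <= eps ^+ 2.
  by apply/andP; split; nra.
have hE x : 1 - x * h = 1 + (- x * h) by ring.
have e4 : eps ^+ 2 <= 4 / 25 by move: e0 e1 => ? ?; nra.
have E4 : iter 4 T (s, 1 + h) = orbit_point 4 s h.
  by rewrite iterS H//= hE step_D//; case/andP: h' => h'; lra.
have E5 : iter 5 T (s, 1 + h) = orbit_point 5 s h.
  have := step_C_strip _ oe h'; rewrite e0 e1 iterS E4 /= hE => -> //.
  by congr pair; rewrite /=; ring.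
have E6 : iter 6 T (s, 1 + h) = orbit_point 6 s h.
  rewrite iterS E5 /= (_ : 1 - _ = 1 + - (16 / 25 * (64 / 125) * h)); last by ring.
  have p1 : 0 < 9 / 5 + 16 / 25 * offset s.
    by rewrite rect_lengthE in s1; rewrite /offset; move: a3 a6 => ? ?; lra.
  have p2 : 0 < - (16 / 25 * (64 / 125) * h) by lra.
  rewrite step_A//; by congr pair; field.
by case=> [|[|[|[|[|[|[|//]]]]]]] // _; exact: H.
Qed.


Definition return_cut : R := (9 / 5 * a - 36 / 25) / (64 / 125).

Local Notation g :=
  (contracted_rotation return_len rate_left rate_right return_cut).

Lemma offsetE s : offset s = 64 / 125 * (return_cut - s).
Proof. by rewrite /offset /return_cut; field. Qed.

Definition avoids_singular (p : R * R) : Prop :=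
  forall i, ~ singular_set (quad a) (iter i T p).

Lemma avoids_singular_iter n p : avoids_singular p -> avoids_singular (iter n T p).
Proof. by move=> ap i; rewrite -iterD; exact: ap. Qed.

(** From the cut, three turns lead to the abscissa 0, on the ray from D to A. *)
Lemma avoids_singular_cut eps s h : in_strip eps s h ->
  avoids_singular (s, 1 + h) -> s != return_cut.
Proof.
move=> sh av; apply/eqP => sc; apply: (av 3%N).
rewrite (orbit_first sh)//= offsetE sc subrr mulr0; apply: singular_DA.
by case: sh => /andP[e0 e1] _ /andP[h1 h0]; lra.
Qed.

Lemma return_rate_bounds b : 0 < @return_rate R b <= rate_left.
Proof. by case: b; rewrite /= /rate_left /rate_right; lra. Qed.

Lemma return_orbit eps s h : in_strip eps s h -> s != return_cut ->
  (forall j, (j < return_time (s < return_cut)%R)%N ->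
    iter j T (s, 1 + h) = orbit_point j s h) /\
  iter (return_time (s < return_cut)%R) T (s, 1 + h) =
    (g s, 1 + return_rate (s < return_cut) * h).
Proof.
move=> sh sc; rewrite /contracted_rotation /return_len; case: ltP => cs /=.
  split=> [j|]; first exact: (orbit_first sh).
  rewrite -[LHS]/(iter 4 T (s, 1 + h)) (orbit_left sh) ?offsetE.
    by congr pair; rewrite /rate_left; field.
  by rewrite mulr_gt0 ?subr_gt0//; lra.
have os : offset s < 0.
  by rewrite offsetE pmulr_rlt0 ?subr_lt0 ?lt_neqAle ?cs ?andbT 1?eq_sym//; lra.
split=> [j j6|]; first by rewrite (orbit_right sh)// ltnW.
rewrite -[LHS]/(iter 6 T (s, 1 + h)) (orbit_right sh)//= offsetE.
by congr pair; rewrite /rate_right; field.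
Qed.

Lemma return_strip eps s h : in_strip eps s h -> s != return_cut ->
  in_strip eps (g s) (return_rate (s < return_cut) * h) /\ - return_len <= g s.
Proof.
move=> [e01 s01 h01] sc.
have gs : - (36 / 25) <= g s < 0.
  have := offsetE s.
  rewrite /contracted_rotation /offset /return_len /rate_left /rate_right.
  move: e01 s01; rewrite rect_lengthE => /andP[e0 e1] /andP[s1 s0].
  by case: ltP => cs oE; move: a3 a6 => ? ?; apply/andP; split; lra.
have [r0 r1] : 0 < @return_rate R (s < return_cut) /\
    @return_rate R (s < return_cut) <= 256 / 625.
  by apply/andP; exact: return_rate_bounds.
have [h1 h0] := andP h01; have [e0 e1] := andP e01.
split; last by case/andP: gs.
split=> //; last by apply/andP; split; nra.
by move: gs; rewrite rect_lengthE; move: a3 a6 => ? ?; lra.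
Qed.

(** Points above the line come below it after three turns. For points below it,
one return brings the abscissa above - len. *)
Lemma enter_strip eps p : 0 < eps < 2 / 5 ->
  (rect1 (4 / 5) a eps `|` rect2 (4 / 5) a eps) p -> avoids_singular p ->
  exists n s h, [/\ iter n T p = (s, 1 + h), in_strip eps s h & - return_len <= s].
Proof.
move=> e01 pR av; have [e0 e1] := andP e01.
have {pR} [s01 h01] : - rect_length (4 / 5) a + eps <= p.1 <= 0 /\
    - eps ^+ 2 <= p.2 - 1 <= eps ^+ 2.
  have e2 := sqr_ge0 eps.
  by case: pR => -[/=]; rewrite !in_itv /= => -> ?; split=> //; lra.
move: p av s01 h01 => [s y] /= av s01 h01.
have ee : eps ^+ 2 < 4 / 25 by move: e0 e1 => ? ?; nra.
have [h yE] : exists h, y = 1 + h by exists (y - 1); ring.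
rewrite {}yE in av h01 *; have {}h01 : - eps ^+ 2 <= h <= eps ^+ 2 by lra.
have s0 : s < 0.
  case/andP: s01 => _; rewrite le_eqVlt => /predU1P[s0|//]; exfalso.
  by apply: (av 0%N); rewrite /= s0; apply: singular_DA; lra.
have {}s01 : - rect_length (4 / 5) a + eps <= s < 0.
  by rewrite s0 andbT; case/andP: s01.
have x0 : a < 9 / 5 + 16 / 25 * s.
  by move: s01; rewrite rect_lengthE => s01; lra.
have x1 : 0 < 9 / 5 + 16 / 25 * s by apply: lt_trans x0; move: a3 => ?; lra.
have E2 : iter 2 T (s, 1 + h) = (9 / 5 + 16 / 25 * s, 1 + 16 / 25 * h).
  by rewrite /= step_D//; [exact: (step_C_strip e01 s01 h01)|lra].
have [h0|h0|h0] := ltgtP h 0.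
- have sh : in_strip eps s h by split=> //; rewrite h0 andbT; case/andP: h01.
  have sc := avoids_singular_cut sh av.
  have [sh' gs] := return_strip sh sc; have [_ rE] := return_orbit sh sc.
  by eexists _, _, _; split; [exact: rE|exact: sh'|exact: gs].
- exists 3%N, (- (4 / 5) * (9 / 5 + 16 / 25 * s)), (- (4 / 5) * (16 / 25 * h)).
  split.
  + by rewrite iterS E2 step_A//; [congr pair; ring|lra].
  + split=> //; last by lra.
    by move: s01; rewrite rect_lengthE; move: a3 a6 => ? ?; lra.
  + by move: s0; rewrite /return_len; lra.
- exfalso; apply: (av 2%N); rewrite E2 h0 mulr0 addr0.
  by apply: singular_AB => //; exact: ltW.
Qed.

End quadrilateral.

(** * Subsets of the plane with gaps in both coordinates *)

Section gapped_sets.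
Context {R : realType}.

(** The closure of D has a dense complement; written with distances so that it
passes to closures in the plane. *)
Definition gapped (D : set R) : Prop := forall u v, u < v ->
  exists2 z, u < z < v & exists2 e, 0 < e & forall d, D d -> e <= `|d - z|.

Lemma gapped_sub (D D' : set R) : D `<=` D' -> gapped D' -> gapped D.
Proof.
by move=> DD' gD u v /gD[z zuv [e e0 De]]; exists z => //; exists e => // d /DD'/De.
Qed.

Lemma gapped0 : gapped set0.
Proof. by move=> u v uv; exists ((u + v) / 2); [lra|exists 1]. Qed.

(** A gap of D contains an interval, in which D' leaves a gap. *)
Lemma gappedU (D D' : set R) : gapped D -> gapped D' -> gapped (D `|` D').
Proof.
move=> gD gD' u v /gD[z zuv [e e0 De]].
have m0 : 0 < Num.min (e / 2) (v - z).
  by rewrite lt_min divr_gt0//; case/andP: zuv; rewrite subr_gt0.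
set m := Num.min _ _ in m0.
have me : m <= e / 2 by rewrite ge_min lexx.
have mv : m <= v - z by rewrite ge_min lexx orbT.
have [|w zw [e' e'0 D'e]] := gD' z (z + m); first by rewrite ltrDl.
exists w; first by move: zw zuv; lra.
exists (Num.min (e / 2) e'); first by rewrite lt_min e'0 divr_gt0.
move=> d [/De dz|/D'e dw]; last by rewrite ge_min dw orbT.
rewrite ge_min; apply/orP; left; have := ler_distD w d z.
by have : `|w - z| <= e / 2; [rewrite ger0_norm; move: zw; lra|lra].
Qed.

Lemma gapped_bigcup (D : nat -> set R) n : (forall j, (j < n)%N -> gapped (D j)) ->
  gapped [set x | exists2 j, (j < n)%N & D j x].
Proof.
elim: n => [|n IHn] gD.
  by apply: gapped_sub gapped0 => x [].
have gn : gapped (D n) by exact: gD.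
have {}IHn := IHn (fun j jn => gD j (ltnW jn : (j < n.+1)%N)).
apply: gapped_sub (gappedU gn IHn) => x [j].
by rewrite ltnS leq_eqVlt => /predU1P[->|jn] Dj; [left|right; exists j].
Qed.

Lemma gapped_affine (D : set R) (x y : R) : x != 0 -> gapped D ->
  gapped [set x * d + y | d in D].
Proof.
move=> x0 gD.
have main x' : 0 < x' -> gapped [set x' * d | d in D].
  move=> {}x0 u v uv.
  have [|z /andP[z1 z2] [e e0 De]] := gD (u / x') (v / x').
    by rewrite ltr_pM2r ?invr_gt0.
  exists (x' * z).
    by move: z1 z2; rewrite ltr_pdivrMr// ltr_pdivlMr// mulrC => -> ->.
  exists (x' * e) => [|_ [d /De ed <-]]; first exact: mulr_gt0.
  by rewrite -mulrBr normrM gtr0_norm// ler_pM2l.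
have gN : gapped [set x * d | d in D].
  move: x0; rewrite neq_lt => /orP[x0|x0]; last exact: main.
  move=> u v uv; have [||z zuv [e e0 De]] := main (- x) _ (- v) (- u); try lra.
  exists (- z); first lra.
  exists e => // _ [d Dd <-]; have := De _ (ex_intro2 _ _ d Dd erefl).
  by rewrite -normrN; congr (_ <= `|_|); ring.
move=> u v uv; have [|z zuv [e e0 De]] := gN (u - y) (v - y); first lra.
exists (z + y); first lra.
exists e => // _ [d Dd <-]; have := De _ (ex_intro2 _ _ d Dd erefl).
by congr (_ <= `|_|); ring.
Qed.

Lemma gapped1 (x : R) : gapped [set x].
Proof.
move=> u v uv; have [xm|xm] := leP x ((u + v) / 2).
  exists ((u + 3 * v) / 4); first lra.
  exists ((v - u) / 4) => [|_ ->]; first lra.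
  by rewrite ler0_norm; lra.
exists ((3 * u + v) / 4); first lra.
exists ((v - u) / 4) => [|_ ->]; first lra.
by rewrite ger0_norm; lra.
Qed.

Lemma closure_gap (f : R * R -> R) (D : set (R * R)) z e :
  (forall p q d, ball p d q -> `|f p - f q| < d) -> 0 < e ->
  (forall d, (f @` D) d -> e <= `|d - z|) -> forall p, closure D p -> f p != z.
Proof.
move=> fb e0 De p /(_ _ (nbhsx_ballx p _ e0))[q [Dq /fb pq]].
apply/eqP => pz; have := De _ (ex_intro2 _ _ q Dq erefl).
by rewrite -pz distrC leNgt pq.
Qed.

(** A vertical or horizontal line that avoids the closure cuts it into two
relatively clopen parts. *)
Lemma closure_separated (D : set (R * R)) (x y : R * R) :
  gapped (fst @` D) -> gapped (snd @` D) -> x != y ->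
  exists V W : set (R * R), [/\ open V, open W, V x, W y &
    closure D `<=` V `|` W /\ closure D `&` V `&` W = set0].
Proof.
move=> g1 g2 xy.
have main (f : R * R -> R) u v : continuous f ->
    (forall p q d, ball p d q -> `|f p - f q| < d) -> gapped (f @` D) ->
    f u < f v -> exists V W : set (R * R), [/\ open V, open W, V u, W v &
    closure D `<=` V `|` W /\ closure D `&` V `&` W = set0].
  move=> cf fb gf /gf[z /andP[uz zv] [e e0 De]].
  exists (f @^-1` [set w | w < z]), (f @^-1` [set w | z < w]); split=> //.
  - by apply: open_comp => // p _; exact: cf.
  - by apply: open_comp => // p _; exact: cf.
  split=> [p /(closure_gap fb e0 De)|].
    by rewrite neq_lt => /orP[|] ?; [left|right].
  by apply/seteqP; split=> // p [[_ /= pz] zp]; have := lt_trans pz zp; rewrite ltxx.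
have sym (f : R * R -> R) : continuous f ->
    (forall p q d, ball p d q -> `|f p - f q| < d) -> gapped (f @` D) ->
    f x != f y -> exists V W : set (R * R), [/\ open V, open W, V x, W y &
    closure D `<=` V `|` W /\ closure D `&` V `&` W = set0].
  move=> cf fb gf; rewrite neq_lt => /orP[|]; first exact: main.
  move=> /(main _ _ _ cf fb gf)[V [W [oV oW Vy Wx [VW VW0]]]].
  by exists W, V; split=> //; rewrite setUC setIAC.
have [x1|] := eqVneq x.1 y.1; last first.
  by apply: sym => // [p|p q d []//]; exact: cvg_fst.
apply: (sym snd) => // [p|p q d []//|]; first exact: cvg_snd.
by apply: contra xy => /eqP x2; rewrite (surjective_pairing x) x1 x2 -surjective_pairing.
Qed.

End gapped_sets.

(** * The attractor *)

Section attractor.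
Context {R : realType} (rho : R).
Hypotheses (rho1 : 1 / 2 < rho < 1) (irr : irrational rho).

Local Notation len := (return_len : R).
Local Notation kL := (rate_left : R).
Local Notation kR := (rate_right : R).
Local Notation rot := (rot rho).
Local Notation phi := (phi len kL kR rho).
Local Notation cut := (cut len kL kR rho).

Let rho01 : 0 < rho < 1. Proof. by have := rho1; lra. Qed.
Let len0 : 0 < len. Proof. by rewrite /return_len; lra. Qed.
Let kR0 : 0 < kR. Proof. by rewrite /rate_right; lra. Qed.
Let kRL : kR <= kL. Proof. by rewrite /rate_right /rate_left; lra. Qed.
Let kL1 : kL < 1. Proof. by rewrite /rate_left; lra. Qed.
Let kL01 : 0 < kL < 1. Proof. by rewrite kL1 (lt_le_trans kR0). Qed.

(** The value of a for which the return map has the cut prescribed by rho; see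
[return_cut]. *)
Definition parameter : R := (36 / 25 + 64 / 125 * cut) / (9 / 5).

Local Notation a := parameter.
Local Notation T := (outer_billiard (4 / 5) (quad a)).

Lemma return_cut_parameter : return_cut a = cut.
Proof. by rewrite /return_cut /parameter; field. Qed.

(** This is where 1/2 < rho is used: then the cut is at most - 9/10. *)
Lemma parameter_itv : 3 / 10 <= a <= 6 / 10.
Proof.
have [c0 _] := andP (cut_itv len0 kR0 kRL kL1 rho01 irr).
have r2 : 1 / 2 < rho by case/andP: rho1.
have c1 := cut_le len0 kR0 kRL kL1 rho01 irr r2.
have c2 : 9 / 10 <= len * (1 - kL) / (1 - kL + kR).
  by rewrite /return_len /rate_left /rate_right ler_pdivlMr; lra.
have c3 : cut <= - (9 / 10) by apply: le_trans c1 _; rewrite lerN2.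
by move: c0; rewrite /parameter /return_len => c0; apply/andP; split; lra.
Qed.

(** The excursions at height 0 that start from the range of [phi]; the number of
points of an excursion depends on the side of the cut. *)
Definition attractor_core : set (R * R) :=
  [set q | exists y j, [/\ 0 <= y < 1, (j < return_time (y < 1 - rho)%R)%N &
     q = orbit_point a j (phi y) 0]].

Definition within_dist (e : R) (p q : R * R) : Prop :=
  `|p.1 - q.1| <= e /\ `|p.2 - q.2| <= e.

Lemma orbit_point_lipschitz j s s' h e : `|s - s'| <= e -> `|h| <= e ->
  within_dist e (orbit_point a j s h) (orbit_point a j s' 0).
Proof.
rewrite !ler_norml => /andP[s1 s2] /andP[h1 h2].
case: j => [|[|[|[|[|[|?]]]]]]; split; rewrite /= ?/offset ler_norml;
  by apply/andP; split; lra.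
Qed.

(** The point p starts an excursion, and it is at distance at most e from the
excursion of [attractor_core] with label x. *)
Definition tracks (eps e x : R) (p : R * R) : Prop :=
  exists s h, [/\ p = (s, 1 + h), in_strip a eps s h, follows len kL kR rho x s,
    `|s - phi x| <= e & `|h| <= e].

Lemma tracks_step eps e x p : tracks eps e x p -> avoids_singular a p ->
  tracks eps (kL * e) (rot x) (iter (return_time (x < 1 - rho)%R) T p) /\
  (forall j, (j < return_time (x < 1 - rho)%R)%N ->
    within_dist e (iter j T p) (orbit_point a j (phi x) 0)).
Proof.
move=> [s [h [-> sh fx sx he]]] av.
have a36 := parameter_itv.
have sc := avoids_singular_cut a36 sh av.
have [jE rE] := return_orbit a36 sh sc.
have [sh' _] := return_strip a36 sh sc.
rewrite return_cut_parameter in sc jE rE sh'.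
have := follows_side len0 kR0 kRL kL1 rho01 irr fx sc => side.
rewrite side in jE rE sh'.
have [fx' sx'] := follows_step len0 kR0 kRL kL1 rho01 irr fx sc.
split; last by move=> j /jE ->; exact: orbit_point_lipschitz.
rewrite rE; eexists _, _; split; [reflexivity|exact: sh'|exact: fx'| |].
- by apply: le_trans sx' _; rewrite ler_pM2l//; case/andP: kL01.
- have [r0 r1] := andP (@return_rate_bounds R (x < 1 - rho)).
  by rewrite normrM (gtr0_norm r0) ler_pM ?normr_ge0 ?(ltW r0).
Qed.

Lemma tracks_iter eps e x p n : tracks eps e x p -> avoids_singular a p ->
  exists2 m, (n <= m)%N & tracks eps (kL ^+ n * e) (iter n rot x) (iter m T p).
Proof.
move=> tp av; elim: n => [|n [m nm IHn]]; first by exists 0%N; rewrite // mul1r.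
have [t' _] := tracks_step IHn (avoids_singular_iter (n := m) av).
exists (return_time (iter n rot x < 1 - rho)%R + m)%N.
  by rewrite -addn1 addnC leq_add ?return_time_gt0.
by rewrite iterD iterS exprS -mulrA.
Qed.

Lemma tracks_ge0 eps e x p : tracks eps e x p -> 0 <= e.
Proof. by move=> [s [h [_ _ _ _ /(le_trans (normr_ge0 _))]]]. Qed.

Lemma tracks_core eps e x p N : tracks eps e x p -> avoids_singular a p ->
  exists2 q, attractor_core q & within_dist e (iter N T p) q.
Proof.
elim/ltn_ind: N e x p => N IHN e x p tp av.
have e0 := tracks_ge0 tp; have [t' jE] := tracks_step tp av.
set m := return_time _ in t' jE; have [Nm|mN] := ltnP N m.
  exists (orbit_point a N (phi x) 0); last exact: jE.
  by exists x, N; split=> //; case: tp => s [h [_ _ [x01 _ _ _] _ _]].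
have m0 : (0 < m)%N := return_time_gt0 _.
have [|q Kq [q1 q2]] := IHN (N - m)%N _ _ _ _ t' (avoids_singular_iter (n := m) av).
  by rewrite ltn_subrL m0 (leq_trans m0 mN).
have ke : kL * e <= e by rewrite -[leRHS]mul1r ler_wpM2r// ltW.
exists q => //; rewrite -(subnK mN) iterD.
by split; [apply: le_trans q1 ke|apply: le_trans q2 ke].
Qed.

Lemma enter_tracks eps p : 0 < eps < 2 / 5 ->
  (rect1 (4 / 5) a eps `|` rect2 (4 / 5) a eps) p -> avoids_singular a p ->
  exists n e x, tracks eps e x (iter n T p).
Proof.
move=> e01 pR av; have a36 := parameter_itv.
have [n [s [h [pE sh ls]]]] := enter_strip a36 e01 pR av.
have [|x fx] := @exists_follows _ len kL kR len0 kR0 kRL kL1 rho rho01 irr s.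
  by rewrite ls; case: sh => _ /andP[].
exists n, (Num.max `|s - phi x| `|h|), x; rewrite pE; exists s, h.
by split=> //; rewrite le_max lexx ?orbT.
Qed.

Lemma within_dist_ball (e d : R) (p q : R * R) :
  within_dist e p q -> e < d -> ball p d q.
Proof. by move=> [h1 h2] ed; split; exact: le_lt_trans ed. Qed.

(** Excursions are longer to the right of the cut, so a point of an excursion has
a counterpart in the excursions with larger labels. *)
Lemma lt_return_time_le y x j : y <= x ->
  (j < return_time (y < 1 - rho)%R)%N -> (j < return_time (x < 1 - rho)%R)%N.
Proof.
move=> yx; have [_ j4|ry] := ltP y (1 - rho); last by rewrite ltNge (le_trans ry).
by case: (x < _) => //; exact: leq_trans j4 _.
Qed.

Lemma core_right_limit (y : R) j d : 0 <= y < 1 ->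
  (j < return_time (y < 1 - rho)%R)%N -> 0 < d ->
  exists2 z, y < z <= 1 & forall x, y <= x < z ->
    attractor_core (orbit_point a j (phi x) 0) /\
    within_dist d (orbit_point a j (phi x) 0) (orbit_point a j (phi y) 0).
Proof.
move=> /andP[y0 y1] jy d0.
have [e e0 ye] := phi_right_cont len0 kR0 kRL kL1 rho y d0.
exists (Num.min 1 (y + e)); first by rewrite lt_min y1 ltrDl e0 ge_min lexx.
move=> x /andP[yx]; rewrite lt_min => /andP[x1 xe]; split.
  exists x, j; split=> //; first by rewrite x1 andbT (le_trans y0).
  exact: lt_return_time_le jy.
apply: orbit_point_lipschitz; last by rewrite normr0 ltW.
have := le_phi len0 kR0 kRL kL1 rho yx; have := ye _ xe => h1 h2.
by rewrite ger0_norm; lra.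
Qed.

(** The labels of the successive excursions form a dense orbit of the rotation, so
that they come back infinitely often just to the right of any y; there [phi] is
close to [phi y]. *)
Lemma tracks_core_cluster eps e x p q : tracks eps e x p -> avoids_singular a p ->
  attractor_core q -> omega_limit T p q.
Proof.
move=> tp av [y [j [y01 jy ->]]] A B [N _ NA] /nbhs_ballP[d d0 dB].
have d3 : 0 < d / 3 by rewrite divr_gt0.
have [z /andP[yz z1] zy] := core_right_limit y01 jy d3.
have [M Me] := exprn_mul_eventually_le e kL01 d3.
have [m nm tm] := tracks_iter (maxn N M) tp av.
have x01 : 0 <= iter (maxn N M) rot x < 1.
  by case: tm => s [h [_ _ []]].
have [n nyz] := iter_rot_dense rho01 irr x01 (proj1 (andP y01)) yz z1.
have avm := avoids_singular_iter (n := m) av.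
have [m' nm' tm'] := tracks_iter n tm avm.
have [_ jE] := tracks_step tm' (avoids_singular_iter (n := m') avm).
have [[x' [j' [x'01 jx' _]]] close] := zy _ nyz.
set w := iter n rot _ in nyz close tm' jE.
have [yw _] := andP nyz; have jw := lt_return_time_le yw jy.
have [w1 w2] := jE j jw; have [c1 c2] := close.
have small : kL ^+ n * (kL ^+ maxn N M * e) <= d / 3.
  by rewrite mulrA -exprD; apply: Me; exact: leq_trans (leq_maxr N M) (leq_addl _ _).
exists (iter (j + (m' + m)) T p); split.
  apply: NA; rewrite /= addnA; apply: leq_trans (leq_addl _ _).
  exact: leq_trans (leq_maxl N M) nm.
apply: dB; rewrite !iterD; apply: (@within_dist_ball (d / 3 + d / 3)); last by lra.
split; rewrite distrC.
- apply: le_trans (ler_distD (orbit_point a j (phi w) 0).1 _ _) _.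
  by rewrite lerD// (le_trans w1).
- apply: le_trans (ler_distD (orbit_point a j (phi w) 0).2 _ _) _.
  by rewrite lerD// (le_trans w2).
Qed.

Lemma omega_limit_iter n (p : R * R) : omega_limit T (iter n T p) = omega_limit T p.
Proof.
apply/seteqP; split=> q cq A B [N _ NA] nB; apply: cq nB.
  exists N => // k Nk /=; rewrite -iterD; apply: NA => /=.
  exact: leq_trans Nk (leq_addr _ _).
exists (N + n)%N => // k /= Nk.
rewrite -(@subnK n k); last exact: leq_trans (leq_addl _ _) Nk.
rewrite iterD; apply: NA => /=.
by rewrite leq_subRL ?(leq_trans (leq_addl _ _) Nk)// addnC.
Qed.

Local Notation K := (closure attractor_core).

Lemma omega_limit_core eps p : 0 < eps < 2 / 5 ->
  (rect1 (4 / 5) a eps `|` rect2 (4 / 5) a eps) p -> avoids_singular a p ->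
  omega_limit T p = K.
Proof.
move=> e01 pR av; have [n [e [x tp]]] := enter_tracks e01 pR av.
rewrite -(omega_limit_iter n p); move: (iter n T p) tp (avoids_singular_iter (n := n) av).
move=> {pR av}p tp av; apply/seteqP; split=> q cq.
  move=> B /nbhs_ballP[d d0 dB].
  have d3 : 0 < d / 3 by rewrite divr_gt0.
  have [M Me] := exprn_mul_eventually_le e kL01 d3.
  have [m _ tm] := tracks_iter M tp av; have avm := avoids_singular_iter (n := m) av.
  have [||? [[N /= mN <-] qN]] :=
    cq [set iter N T p | N in [set N | (m <= N)%N]] (ball q (d / 3)).
  - by exists m => // k /= mk; exists k.
  - exact: nbhsx_ballx.
  have [r Kr wr] := tracks_core (N - m) tm avm.
  rewrite -iterD subnK// in wr; exists r; split=> //; apply: dB.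
  apply: (@le_ball _ _ _ (d / 3 + (d / 3 + d / 3))); first by lra.
  apply: ball_triangle qN _; apply: within_dist_ball wr _.
  by apply: le_lt_trans (Me _ (leqnn M)) _; lra.
move=> A B FA /nbhs_ballP[d d0 dB].
have d2 : 0 < d / 2 by rewrite divr_gt0.
have [r [Kr qr]] := cq _ (nbhsx_ballx q _ d2).
have [w [Aw rw]] := tracks_core_cluster tp av Kr FA (nbhsx_ballx r _ d2).
exists w; split=> //; apply: dB; rewrite [d]splitr; exact: ball_triangle qr rw.
Qed.

Lemma orbit_point_fst j : (j < 6)%N ->
  exists2 xy : R * R, xy.1 != 0 &
    forall s, (orbit_point a j s 0).1 = xy.1 * s + xy.2.
Proof.
pose o := 9 / 5 * a - 36 / 25.
case: j => [|[|[|[|[|[|//]]]]]] _.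
- by exists (1, 0) => [|s] /=; [rewrite oner_neq0|ring].
- by exists (- (4 / 5), 0) => [|s] /=; [by apply/eqP; lra|ring].
- by exists (16 / 25, 9 / 5) => [|s] /=; [by apply/eqP; lra|ring].
- by exists (- (64 / 125), o) => [|s] /=; [by apply/eqP; lra|rewrite /offset /o; ring].
- exists (4 / 5 * (64 / 125), - (4 / 5) * o) => [|s] /=; first by apply/eqP; lra.
  by rewrite /offset /o; ring.
- exists (- (16 / 25 * (64 / 125)), 9 / 5 + 16 / 25 * o) => [|s] /=; first by apply/eqP; lra.
  by rewrite /offset /o; ring.
Qed.

Lemma return_time_le6 b : (return_time b <= 6)%N.
Proof. by case: b. Qed.

Lemma gapped_phi : gapped [set phi y | y in [set y | 0 <= y < 1]].
Proof.
move=> u v /(phi_range_gap len0 kR0 kRL kL1 rho01 irr)[z zuv [e e0 ze]].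
by exists z => //; exists e => // _ [y y01 <-]; exact: ze.
Qed.

Lemma core_fst_gapped : gapped (fst @` attractor_core).
Proof.
pose D j := [set (orbit_point a j d 0).1
            | d in [set phi y | y in [set y | 0 <= y < 1]]].
apply: gapped_sub (@gapped_bigcup _ D 6 _).
  move=> _ [_ [y [j [y01 jy ->]] <-]]; exists j.
    exact: leq_trans jy (return_time_le6 _).
  by exists (phi y) => //; exists y.
move=> j /orbit_point_fst[[x y] /= x0 E].
apply: gapped_sub (gapped_affine y x0 gapped_phi) => _ [d Pd <-].
by exists d => //; rewrite E.
Qed.

Lemma core_snd_gapped : gapped (snd @` attractor_core).
Proof.
apply: gapped_sub (gappedU (gapped1 1) (gapped1 (- (4 / 5)))).
move=> _ [_ [y [j [_ _ ->]] <-]].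
by case: j => [|[|[|[|[|[|?]]]]]];
  [left|right|left|left|right|left|left] => /=; ring.
Qed.

Lemma core_bounded : attractor_core `<=` `[-3, 3] `*` `[-3, 3].
Proof.
have a36 := parameter_itv.
move=> _ [y [j [y01 _ ->]]].
have p0 := phi_lt0 len0 kR0 kRL kL1 rho01 irr y01.
have := phi_ge len0 kR0 kRL kL1 rho y; rewrite {1}/return_len => p1.
rewrite /= !in_itv /=; move: (phi y) p0 p1 => s p0 p1.
by case: j => [|[|[|[|[|[|?]]]]]]; rewrite /= /offset; split; lra.
Qed.

Lemma attractor_compact : compact K.
Proof.
have cB : compact (`[-3, 3] `*` `[-3, 3] : set (R * R)).
  by apply: compact_setX; exact: segment_compact.
apply: (subclosed_compact _ cB); first exact: closed_closure.
have /closure_id -> : closed (`[-3, 3] `*` `[-3, 3] : set (R * R)).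
  by apply: compact_closed => //; exact: norm_hausdorff.
exact/closure_subset/core_bounded.
Qed.

Lemma attractor_perfect x A : K x -> nbhs x A -> exists y, [/\ K y, A y & y != x].
Proof.
move=> Kx /nbhs_ballP[d d0 dA].
have d2 : 0 < d / 2 by rewrite divr_gt0.
have d4 : 0 < d / 4 by rewrite divr_gt0.
have [q [Cq xq]] := Kx _ (nbhsx_ballx x _ d2).
have [qx|qx] := eqVneq q x; last first.
  exists q; split=> //; first exact: subset_closure.
  by apply: dA; apply: le_ball xq; lra.
have [y [j [y01 jy qE]]] := Cq.
have [z /andP[yz z1] zy] := core_right_limit y01 jy d4.
have [|Cr wr] := zy ((y + z) / 2); first by apply/andP; split; lra.
exists (orbit_point a j (phi ((y + z) / 2)) 0); split.
- exact: subset_closure.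
- rewrite -qx qE in dA; apply: dA; apply: ball_sym.
  by apply: within_dist_ball wr _; lra.
rewrite -qx qE; apply/eqP => /(congr1 fst).
have [|[u v] /= u0 E] := @orbit_point_fst j.
  exact: leq_trans jy (return_time_le6 _).
rewrite !E => /addIr /(mulfI u0) E'.
have : phi y < phi ((y + z) / 2).
  by apply: (lt_phi len0 kR0 kRL kL1 rho01 irr); case/andP: y01; lra.
by rewrite E' ltxx.
Qed.

Lemma attractor_Cantor : is_Cantor_set R K.
Proof.
apply: is_Cantor_set_cantor_space; apply: (@homeomorphic_cantor_space R).
- exact: norm_hausdorff.
- exists (orbit_point a 0 (phi 0) 0); apply: subset_closure; exists 0, 0%N.
  by split; rewrite ?lexx ?ltr01 ?return_time_gt0.
- exact: attractor_compact.
- exact: attractor_perfect.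
- by move=> x y _ _; apply: closure_separated core_fst_gapped core_snd_gapped.
Qed.

End attractor.

Lemma parameter_inj (R : realType) (rho rho' : R) :
  1 / 2 < rho < 1 -> 1 / 2 < rho' < 1 -> irrational rho -> irrational rho' ->
  parameter rho = parameter rho' -> rho = rho'.
Proof.
move=> r r' irr irr' E.
apply: (@cut_inj R return_len rate_left rate_right) => //.
- by rewrite /return_len; lra.
- by rewrite /rate_right; lra.
- by rewrite /rate_right /rate_left; lra.
- by rewrite /rate_left; lra.
- by move: r; lra.
- by move: r'; lra.
- by move: E; rewrite /parameter; lra.
Qed.

(** * Uncountably many parameters *)

Lemma irrational_uncountable (R : realType) (u v : R) : u < v ->
  ~ countable (`]u, v[ `&` @irrational R).
Proof.
move=> uv cI; have : countable (`]u, v[%classic : set R).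
  apply: (@sub_countable _ _ _ ((`]u, v[ `&` @irrational R) `|` @rational R)).
    apply: subset_card_le => x xuv; have [|] := pselect (rational x); first by right.
    by left.
  rewrite -bigcup2E; apply: bigcup_countable => // -[|[|?]] _ //=.
  by apply: sub_countable (card_image_le _ _) _.
move=> /countable_lebesgue_measure0; rewrite lebesgue_measure_itv /= lte_fin uv.
by move=> /eqP; rewrite -EFinB eqe subr_eq0 gt_eqF.
Qed.

Theorem theorem2 (R : realType) :
  let lam : R := 8 / 10 in
  ~ countable [set a : R | 3 / 10 <= a <= 6 / 10 /\
      exists2 eps0 : R, 0 < eps0 & forall eps : R, 0 < eps < eps0 ->
        exists K : set (R * R), is_Cantor_set R K /\
          forall p : R * R,
            (regular_points lam (quad a) `&`
               (rect1 lam a eps `|` rect2 lam a eps)) p ->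
            asymptotic_to (outer_billiard lam (quad a)) p K].
Proof.
move=> lam; set good := [set a : R | _] => /countable_injP[f finj].
have half1 : 1 / 2 < 1 :> R by lra.
apply: (irrational_uncountable half1); apply/countable_injP.
have lamE : lam = 4 / 5 by rewrite /lam; field.
have par s : 1 / 2 < s < 1 -> irrational s -> parameter s \in good.
  move=> s1 irrs; rewrite inE; split; first exact: parameter_itv.
  exists (2 / 5) => [|eps e01]; first lra.
  exists (closure (attractor_core s)); split; first exact: attractor_Cantor.
  rewrite lamE => p [reg pR]; apply: omega_limit_core e01 pR _ => // i Si.
  by apply: reg; right; exists i.
have mem s : s \in `]1 / 2, 1[ `&` @irrational R ->
    1 / 2 < s < 1 /\ irrational s.
  by rewrite inE /= => -[]; rewrite in_itv.
exists (f \o @parameter R) => r r' /mem[r1 irr] /mem[r1' irr'] /= ff.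
exact: parameter_inj r1 r1' irr irr' (finj _ _ (par _ r1 irr) (par _ r1' irr') ff).
Qed.
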